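(* Let $N\geq2$, let $\mu$ be a Radon measure on $\mathbb{R}^N$, let $s>1$, and let $p,q>0$. Then the restricted measure $$\mu\llcorner\left\{x\in\mathbb{R}^N:\int_0^1\beta_p^{(1)}(\mu,x,r)^q\,\frac{r^s}{\mu(B(x,r))}\,\frac{dr}{r}<\infty\ \text{ and }\ \limsup_{r\downarrow0}\frac{\mu(B(x,2r))}{\mu(B(x,r))}<\infty\right\}$$ is carried by $(1/s)$-Hölder curves.
   Context: A Radon measure on $\mathbb{R}^N$ is a locally finite Borel regular measure. $B(x,r)$ is the open ball. $\mu\llcorner A$ is the restriction of $\mu$ to $A$. For a line $L\subset\mathbb{R}^N$, $p>0$, $x\in\mathbb{R}^N$, $r>0$, $$\beta_p^{(1)}(\mu,x,r,L):=\left(\int_{B(x,r)}\left(\frac{\operatorname{dist}(z,L)}{r}\right)^p\frac{d\mu(z)}{\mu(B(x,r))}\right)^{1/p},\qquad \beta_p^{(1)}(\mu,x,r):=\inf_L\beta_p^{(1)}(\mu,x,r,L),$$ where the infimum is over all straight lines $L$ in $\mathbb{R}^N$. These expressions are considered only at points $x$ with $\mu(B(x,r))>0$ for all $r>0$ (i.e. $x$ in the support of $\mu$); the remaining points form a $\mu$-null set and are excluded. A $(1/s)$-Hölder curve in $\mathbb{R}^N$ is the image of a map $f:[0,1]\to\mathbb{R}^N$ with $|f(x)-f(y)|\leq H|x-y|^{1/s}$ for all $x,y\in[0,1]$ and some finite $H$. A measure $\nu$ on $\mathbb{R}^N$ is carried by $(1/s)$-Hölder curves if there are countably many $(1/s)$-Hölder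 curves $\Gamma_1,\Gamma_2,\dots$ with $\nu(\mathbb{R}^N\setminus\bigcup_i\Gamma_i)=0$. *)

(* Defs.v *)
From HB Require Import structures.
From mathcomp Require Import all_boot all_order all_algebra.
From mathcomp Require Import all_classical all_reals all_analysis.
Import Order.TTheory GRing.Theory Num.Theory.
Import numFieldNormedType.Exports.

Set Implicit Arguments.
Unset Strict Implicit.
Unset Printing Implicit Defensive.

Local Open Scope classical_set_scope.
Local Open Scope ring_scope.

(* R^N is 'rV[R]_N.  The library's metric on 'rV[R]_N is the sup metric, so the
   Euclidean norm, distance and balls are defined here; the topology is the
   same. *)
Definition enorm (R : realType) (N : nat) (x : 'rV[R]_N) : R :=
  Num.sqrt (\sum_(i < N) x 0 i ^+ 2).

Definition eball (R : realType) (N : nat) (x : 'rV[R]_N) (r : R) :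
    set 'rV[R]_N :=
  [set z | enorm (z - x) < r].

Definition edist_set (R : realType) (N : nat) (z : 'rV[R]_N)
    (A : set 'rV[R]_N) : R :=
  inf [set enorm (z - y) | y in A].

Definition is_line (R : realType) (N : nat) (L : set 'rV[R]_N) : Prop :=
  exists a v : 'rV[R]_N, v != 0 /\ L = [set a + t *: v | t in [set: R]].

Definition borel_set (R : realType) (N : nat) : set (set 'rV[R]_N) :=
  <<s [set U : set 'rV[R]_N | open U] >>.

(* As usual in geometric measure theory, a measure on R^N is defined on all
   subsets (an outer measure); it is Borel regular if Borel sets are
   Caratheodory measurable and every set is contained in a Borel set of the
   same measure. *)
Definition borel_regular (R : realType) (N : nat)
    (mu : {outer_measure set 'rV[R]_N -> \bar R}) : Prop :=
  (forall B, borel_set B -> mu.-caratheodory B) /\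
  (forall A, exists B, [/\ borel_set B, A `<=` B & mu B = mu A]).

Definition locally_finite_measure (R : realType) (N : nat)
    (mu : {outer_measure set 'rV[R]_N -> \bar R}) : Prop :=
  forall x, exists2 r : R, 0 < r & (mu (eball x r) < +oo)%E.

Definition radon_measure (R : realType) (N : nat)
    (mu : {outer_measure set 'rV[R]_N -> \bar R}) : Prop :=
  borel_regular mu /\ locally_finite_measure mu.

Definition omrestr (R : realType) (T : Type)
    (mu : {outer_measure set T -> \bar R}) (A : set T) : set T -> \bar R :=
  fun E => mu (E `&` A).

Section omrestr_outer_measure.
Variables (R : realType) (T : Type) (mu : {outer_measure set T -> \bar R}).
Variable A : set T.

Let omrestr0 : omrestr mu A set0 = 0%E.
Proof. by rewrite /omrestr set0I outer_measure0. Qed.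

Let omrestr_ge0 E : (0 <= omrestr mu A E)%E.
Proof. exact: outer_measure_ge0. Qed.

Let le_omrestr : {homo omrestr mu A : E F / E `<=` F >-> (E <= F)%E}.
Proof. by move=> E F EF; apply: le_outer_measure; exact: setSI. Qed.

Let omrestr_sigma_subadditive : sigma_subadditive (omrestr mu A).
Proof.
move=> F; rewrite /omrestr setI_bigcupl.
exact: outer_measure_sigma_subadditive.
Qed.

HB.instance Definition _ := isOuterMeasure.Build R T (omrestr mu A)
  omrestr0 omrestr_ge0 le_omrestr omrestr_sigma_subadditive.
End omrestr_outer_measure.

Section beta_number.
Local Open Scope ereal_scope.
Variables (R : realType) (N : nat).
Variables (mu : {outer_measure set 'rV[R]_N -> \bar R}).

(* The integral is taken against the measure induced by mu on its Caratheodory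
   measurable sets. *)
Definition beta_line (p : R) (x : 'rV[R]_N) (r : R) (L : set 'rV[R]_N) :
    \bar R :=
  (\int[(mu : set (caratheodory_type mu) -> \bar R)]_(z in eball x r)
     (((edist_set z L / r) `^ p)%:E / mu (eball x r))) `^ p^-1.

Definition beta_number (p : R) (x : 'rV[R]_N) (r : R) : \bar R :=
  ereal_inf [set beta_line p x r L | L in @is_line R N].

End beta_number.

Definition msupport (R : realType) (N : nat)
    (mu : {outer_measure set 'rV[R]_N -> \bar R}) : set 'rV[R]_N :=
  [set x | forall r : R, 0 < r -> (0 < mu (eball x r))%E].

Definition jones_function (R : realType) (N : nat)
    (mu : {outer_measure set 'rV[R]_N -> \bar R}) (s p q : R)
    (x : 'rV[R]_N) : \bar R :=
  (\int[lebesgue_measure]_(r in `]0%R, 1%R[)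
     (beta_number mu p x r `^ q * ((r `^ s)%:E / mu (eball x r)) * (r^-1)%:E))%E.

Definition upper_doubling (R : realType) (N : nat)
    (mu : {outer_measure set 'rV[R]_N -> \bar R}) (x : 'rV[R]_N) : \bar R :=
  limf_esup (fun r : R => mu (eball x (2 * r)) / mu (eball x r))%E 0^'+.

Definition holder_curve (R : realType) (N : nat) (s : R)
    (G : set 'rV[R]_N) : Prop :=
  exists (f : R -> 'rV[R]_N) (H : R),
    (forall x y : R, x \in `[0, 1] -> y \in `[0, 1] ->
       enorm (f x - f y) <= H * `|x - y| `^ s^-1) /\
    G = f @` `[0, 1].

Definition carried_by_holder_curves (R : realType) (N : nat) (s : R)
    (nu : {outer_measure set 'rV[R]_N -> \bar R}) : Prop :=
  exists G : (set 'rV[R]_N)^nat,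
    (forall i, holder_curve s (G i)) /\ nu (~` (\bigcup_i G i)) = 0%E.

(* Main.v *)
Require Import Defs.
From HB Require Import structures.
From mathcomp Require Import all_boot all_order all_algebra.
From mathcomp Require Import all_classical all_reals all_analysis.
From mathcomp Require Import measurable_realfun.
From mathcomp Require Import ring lra.
Import Order.TTheory GRing.Theory Num.Theory.
Import numFieldNormedType.Exports.

(** Let [A] be a set of small diameter on which the Jones function is bounded by
    [M], and [mu] is doubling with a uniform constant below a fixed scale;
    countably many such sets cover the set of the theorem ([piece_cover]).
    Let [r k = r0 * rho ^ k], and let the [k]-th net of a subset [E] of [A] be a
    maximal [r k]-separated subset of [E].

    Choosing for each point of a net a parent in the previous one makes the nets
    the levels of a tree.  If [\sum_k \sum_(x in the k-th net) r k ^ s] is finite,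
    then visiting the tree in depth-first order, with time increments of order
    [r k ^ s], gives a [1/s]-Hoelder map on a set of times, which extends to an
    interval by McShane's formula; its image contains [E]
    ([tree_holder_curve]).

    To bound this sum, call the ball of [x] of radius [r k] flat if its points of
    [E] are [rho / 4 * r k]-close to a line.  Such a ball has [O(1 / rho)]
    children, which contribute [O(rho ^ (s - 1)) * r k ^ s], at most half of the
    contribution of the parent when [rho] is small, because [1 < s].  Nonflat balls
    have boundedly many children.  So the whole sum is finite as soon as the sum
    over nonflat balls is ([summable_nonflat_holder_curve]).

    By doubling, around a nonflat ball all the numbers [beta mu y r], for [y] in
    [A] close to [x] and [r] between [3 * r k] and [4 * r k], are bounded below
    ([beta_number_ge]).  Hence the sum over nonflat balls [B] of
    [r k ^ s / mu B * 1_B] is [O(M)] on [A] ([jones_packing]), and integrating over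
    [A] bounds the sum of [r k ^ s * mu (A `&` B) / mu B].  This is the required
    bound if [mu (A `&` B)] is comparable to [mu B] for all balls in play
    ([nonflat_content]).  Finally, Vitali's covering argument shows that the
    points of [A] having a ball in which [A] has density below [kappa] form a set
    of measure [O(kappa)] ([low_density_measure]); letting [kappa] tend to [0]
    through the numbers [1/n] exhausts [A] up to a null set ([piece_carried]).

    Neither [A] nor the Jones function needs to be measurable: [mu] is an outer
    measure, only balls are used as measurable sets, and integrals are only
    bounded below by those of step functions. *)

Set Implicit Arguments.
Unset Strict Implicit.
Unset Printing Implicit Defensive.

Local Open Scope classical_set_scope.
Local Open Scope ring_scope.

(** * The Euclidean norm *)

Section euclidean_norm.
Variables (R : realType) (N : nat).
Implicit Types (x y z : 'rV[R]_N) (r : R).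

Lemma enorm_ge0 x : 0 <= enorm x.
Proof. exact: sqrtr_ge0. Qed.

Lemma enorm0 : enorm (0 : 'rV[R]_N) = 0.
Proof. by rewrite /enorm big1 ?sqrtr0// => i _; rewrite mxE expr0n. Qed.

Lemma enormZ (a : R) x : enorm (a *: x) = `|a| * enorm x.
Proof.
rewrite /enorm -sqrtr_sqr -sqrtrM ?sqr_ge0// mulr_sumr.
by congr Num.sqrt; apply: eq_bigr => i _; rewrite mxE exprMn.
Qed.

Lemma enormN x : enorm (- x) = enorm x.
Proof. by rewrite -scaleN1r enormZ normrN1 mul1r. Qed.

Lemma enormC x y : enorm (x - y) = enorm (y - x).
Proof. by rewrite -enormN opprB. Qed.

Lemma sqr_enorm x : enorm x ^+ 2 = \sum_(i < N) x 0 i ^+ 2.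
Proof. by rewrite sqr_sqrtr// sumr_ge0// => i _; exact: sqr_ge0. Qed.

Lemma enorm_eq0 x : enorm x = 0 -> x = 0.
Proof.
move=> x0; have := sqr_enorm x; rewrite x0 expr0n/= => /esym/eqP.
rewrite psumr_eq0; last by move=> i _; exact: sqr_ge0.
move=> /allP h; apply/rowP => i; rewrite mxE.
by have := h i (mem_index_enum _); rewrite /= sqrf_eq0 => /eqP.
Qed.

Lemma enorm_coord x i : `|x 0 i| <= enorm x.
Proof.
rewrite -sqrtr_sqr ler_wsqrtr// (bigD1 i)//= lerDl sumr_ge0// => j _.
exact: sqr_ge0.
Qed.

(** The Cauchy-Schwarz inequality. *)
Lemma dot_le_enorm x y :
  \sum_(i < N) x 0 i * y 0 i <= enorm x * enorm y.
Proof.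
have [x0|x0] := eqVneq (enorm x) 0.
  rewrite (enorm_eq0 x0) enorm0 mul0r big1// => i _; first by rewrite mxE mul0r.
have [y0|y0] := eqVneq (enorm y) 0.
  rewrite (enorm_eq0 y0) enorm0 mulr0 big1// => i _; first by rewrite mxE mulr0.
set a := enorm x; set b := enorm y.
have a0 : 0 < a by rewrite lt_neqAle eq_sym x0 enorm_ge0.
have b0 : 0 < b by rewrite lt_neqAle eq_sym y0 enorm_ge0.
have : 0 <= \sum_(i < N) (b * x 0 i - a * y 0 i) ^+ 2.
  by apply: sumr_ge0 => i _; exact: sqr_ge0.
have -> : \sum_(i < N) (b * x 0 i - a * y 0 i) ^+ 2 =
    b ^+ 2 * (\sum_(i < N) x 0 i ^+ 2) + a ^+ 2 * (\sum_(i < N) y 0 i ^+ 2)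
    - 2 * a * b * \sum_(i < N) x 0 i * y 0 i.
  rewrite !mulr_sumr -sumrN -!big_split/=; apply: eq_bigr => i _; ring.
rewrite -!sqr_enorm -/a -/b.
have -> : b ^+ 2 * a ^+ 2 + a ^+ 2 * b ^+ 2 -
    2 * a * b * (\sum_(i < N) x 0 i * y 0 i) =
    (2 * a * b) * (a * b - \sum_(i < N) x 0 i * y 0 i) by ring.
by rewrite pmulr_rge0 ?subr_ge0// !mulr_gt0.
Qed.

Lemma enormD x y : enorm (x + y) <= enorm x + enorm y.
Proof.
rewrite -(@ler_pXn2r _ 2)// ?nnegrE ?addr_ge0 ?enorm_ge0//.
have -> : enorm (x + y) ^+ 2 =
    enorm x ^+ 2 + enorm y ^+ 2 + 2 * \sum_(i < N) x 0 i * y 0 i.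
  rewrite !sqr_enorm mulr_sumr -!big_split/=; apply: eq_bigr => i _.
  by rewrite mxE; ring.
by have := dot_le_enorm x y; lra.
Qed.

Lemma enorm_triangle y x z : enorm (x - z) <= enorm (x - y) + enorm (y - z).
Proof. by rewrite -(subrKA y); exact: enormD. Qed.

Lemma enorm_le_coord x r : 0 <= r -> (forall i, `|x 0 i| <= r) ->
  enorm x <= N%:R * r.
Proof.
move=> r0 xr; rewrite -(ger0_norm (mulr_ge0 (ler0n _ N) r0)) -sqrtr_sqr.
rewrite ler_wsqrtr// (@le_trans _ _ (\sum_(i < N) r ^+ 2))//.
  by apply: ler_sum => i _; rewrite -real_normK ?num_real// lerXn2r ?nnegrE.
rewrite sumr_const card_ord -[leLHS]mulr_natl exprMn ler_wpM2r ?sqr_ge0//.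
by rewrite -natrX ler_nat; case: (N) => // n; rewrite expnS leq_pmulr// expn1.
Qed.

Lemma sub_eball x y r r' : enorm (y - x) + r' <= r -> eball y r' `<=` eball x r.
Proof.
move=> h z; rewrite /eball /= => zy.
have := enorm_triangle y z x; lra.
Qed.

Lemma le_eball x r r' : r <= r' -> eball x r `<=` eball x r'.
Proof. by move=> rr; apply: sub_eball; rewrite subrr enorm0 add0r. Qed.

(** [ball] is the ball of the sup norm, which defines the topology. *)
Lemma enorm_ball x y r : 0 <= r -> ball x r y -> enorm (y - x) <= N%:R * r.
Proof.
move=> r0 xy; apply: enorm_le_coord => // i; rewrite !mxE distrC.
by case: xy => _ xy; apply: ltW; exact: xy.
Qed.

Lemma open_eball x r : open (eball x r).
Proof.
rewrite openE => y; rewrite /eball /= /interior => yr.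
apply/nbhs_ballP; exists ((r - enorm (y - x)) / N.+1%:R) => /=.
  by rewrite divr_gt0 ?subr_gt0.
move=> z yz; have := enorm_ball _ yz.
set d := r - _ => h; have d0 : 0 < d by rewrite subr_gt0.
have {}h := h (ltW (divr_gt0 d0 (ltr0Sn _ _))).
have lt : N%:R * (d / N.+1%:R) < d.
  by rewrite mulrCA gtr_pMr// ltr_pdivrMr// mul1r ltr_nat.
have h2 : enorm (z - y) < r - enorm (y - x) := le_lt_trans h lt.
by rewrite /eball /=; have := enorm_triangle y z x; lra.
Qed.

Lemma borel_eball x r : borel_set (eball x r).
Proof. by apply: sub_sigma_algebra => /=; exact: open_eball. Qed.

End euclidean_norm.

(** * Extension of Hoelder maps *)

Lemma powR_subadd (R : realType) (a b e : R) : 0 <= a -> 0 <= b ->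
  0 < e <= 1 -> (a + b) `^ e <= a `^ e + b `^ e.
Proof.
move=> a0 b0 /andP[e0 e1].
have [ab0|ab0] := leP (a + b) 0.
  have -> : a + b = 0 by lra.
  by rewrite powR0 ?gt_eqF// addr_ge0 ?powR_ge0.
set c := a + b in ab0 *.
have aux u : 0 <= u <= c -> u / c * c `^ e <= u `^ e.
  move=> /andP[u0 uc]; have [->|un0] := eqVneq u 0; first by rewrite !mul0r powR_ge0.
  have up : 0 < u by rewrite lt_neqAle eq_sym un0.
  rewrite -[in leRHS](divfK (lt0r_neq0 ab0) u) powRM ?divr_ge0// ?(ltW ab0)//.
  rewrite ler_wpM2r ?powR_ge0//.
  rewrite -[leLHS]powRr1 ?divr_ge0 ?(ltW ab0)//.
  by rewrite ger_powR ?divr_gt0//= ler_pdivrMr// mul1r.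
have -> : c `^ e = a / c * c `^ e + b / c * c `^ e.
  by rewrite -mulrDl -mulrDl divff ?mul1r// gt_eqF.
by rewrite lerD// aux /c// ?lerDl ?lerDr ?a0 ?b0.
Qed.

(** McShane's extension, applied to each coordinate: [t |-> t `^ e] is
    subadditive, so [`|t - t'| `^ e] is a metric on the line. *)
Lemma holder_extension (R : realType) (N : nat) (I : Type) (i0 : I)
    (t : I -> R) (x : I -> 'rV[R]_N) (H e : R) : 0 <= H -> 0 < e <= 1 ->
  (forall i j, enorm (x i - x j) <= H * `|t i - t j| `^ e) ->
  exists f : R -> 'rV[R]_N, (forall i, f (t i) = x i) /\
    forall a b, enorm (f a - f b) <= N%:R * H * `|a - b| `^ e.
Proof.
move=> H0 e01 hx.
have e0 : 0 < e by case/andP: e01.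
pose S k a := [set x i 0 k + H * `|a - t i| `^ e | i in [set: I]].
have lbS k a i : x i0 0 k - H * `|a - t i0| `^ e <= x i 0 k + H * `|a - t i| `^ e.
  have := enorm_coord (x i0 - x i) k; rewrite !mxE.
  move=> /le_trans /(_ (hx i0 i)) h1.
  have h2 : `|t i0 - t i| `^ e <= `|a - t i0| `^ e + `|a - t i| `^ e.
    apply: le_trans (powR_subadd _ _ e01) => //.
    apply: ge0_ler_powR; rewrite ?nnegrE ?(ltW e0)//.
    by rewrite (distrC a (t i0)) ler_distD.
  have := ler_norm (x i0 0 k - x i 0 k) => h3.
  have := ler_wpM2l H0 h2; rewrite mulrDr; lra.
have hinf k a : has_inf (S k a).
  split; first by exists (x i0 0 k + H * `|a - t i0| `^ e), i0.
  by exists (x i0 0 k - H * `|a - t i0| `^ e) => _ [i _ <-]; exact: lbS.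
pose g k a := inf (S k a).
have gle k a i : g k a <= x i 0 k + H * `|a - t i| `^ e.
  by apply: ge_inf; [exact: (hinf k a).2|exists i].
have ghol k a b : g k a <= g k b + H * `|a - b| `^ e.
  rewrite -lerBlDr; apply: lb_le_inf; first exact: (hinf k b).1.
  move=> _ [i _ <-]; rewrite lerBlDr (le_trans (gle k a i))//.
  rewrite -addrA lerD2l -mulrDr ler_wpM2l//.
  apply: le_trans (powR_subadd _ _ e01) => //.
  apply: ge0_ler_powR; rewrite ?nnegrE ?(ltW e0)//.
  by rewrite (addrC `|b - t i|) ler_distD.
exists (fun a => \row_k g k a); split=> [i|a b].
  apply/rowP => k; rewrite mxE; apply/eqP; rewrite eq_le; apply/andP; split.
    by rewrite (le_trans (gle k _ i))// subrr normr0 powR0 ?gt_eqF// mulr0 addr0.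
  apply: lb_le_inf; first exact: (hinf k _).1.
  move=> _ [j _ <-]; have := enorm_coord (x i - x j) k; rewrite !mxE.
  move=> /le_trans /(_ (hx i j)) h1.
  by have := ler_norm (x i 0 k - x j 0 k); lra.
rewrite -mulrA; apply: enorm_le_coord; first by rewrite mulr_ge0 ?powR_ge0.
move=> k; rewrite !mxE ler_norml.
have := ghol k a b; have := ghol k b a; rewrite (distrC b a); lra.
Qed.

Lemma holder_continuous (R : realType) (N : nat) (f : R -> 'rV[R]_N) (H e : R) :
  0 <= H -> 0 < e ->
  (forall a b, enorm (f a - f b) <= H * `|a - b| `^ e) -> continuous f.
Proof.
move=> H0 e0 hf a; apply/cvgrPdist_lt => /= eps eps0.
pose d := (eps / (H + 1)) `^ e^-1.
have q0 : 0 < eps / (H + 1) by rewrite divr_gt0// ltr_wpDl.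
near=> b.
have ab : `|a - b| < d by near: b; apply/nbhs_ballP; exists d => //=; exact: powR_gt0.
have : `|a - b| `^ e < eps / (H + 1).
  rewrite (_ : eps / (H + 1) = d `^ e); last first.
    by rewrite -powRrM mulVf ?gt_eqF// powRr1 ?ltW.
  by apply: gt0_ltr_powR; rewrite ?nnegrE ?powR_ge0.
rewrite ltr_pdivlMr ?ltr_wpDl// => h.
apply: le_lt_trans (_ : enorm (f a - f b) < eps).
  rewrite /Num.norm /= mx_normrE; apply: bigmax_le => //=.
  - exact: enorm_ge0.
  - by move=> [i j] _ /=; rewrite ord1; exact: enorm_coord.
apply: le_lt_trans (hf a b) (le_lt_trans _ h).
by rewrite mulrC ler_wpM2l ?powR_ge0// lerDl.
Unshelve. all: by end_near. Qed.

(** * Hoelder curves through trees *)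

(** Nodes of a tree are encoded by their addresses: the root is [[::]], and
    [rcons a i] is the [i]-th child of the node [a].  [coef u y] is [1] when [y]
    is a strict ancestor of [u], [2] when [y] and its whole subtree precede [u]
    in depth-first order, and [0] otherwise. *)
Fixpoint coef (u y : seq nat) : nat :=
  match u, y with
  | _ :: _, [::] => 1
  | d :: u', c :: y' => if (c < d)%N then 2 else if c == d then coef u' y' else 0
  | [::], _ => 0
  end.

(** Strict depth-first order on addresses. *)
Fixpoint before (v u : seq nat) : bool :=
  match v, u with
  | [::], _ :: _ => true
  | c :: v', d :: u' => (c < d)%N || ((c == d) && before v' u')
  | _, [::] => false
  end.

Lemma before_total u v : u != v -> before u v || before v u.
Proof.
elim: u v => [|c u ih] [|d v] //=.
rewrite eqseq_cons negb_and => h.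
case: (ltngtP c d) h => //= _ h; exact: ih.
Qed.

Lemma coef_le2 u y : (coef u y <= 2)%N.
Proof.
elim: u y => [|d u ih] [|c y] //=; case: ifP => // _; case: ifP => // _; exact: ih.
Qed.

Lemma coef_before v u y : before v u -> (coef v y <= coef u y)%N.
Proof.
elim: v u y => [|c v ih] [|d u] //= [|e y] //= /orP[cd|/andP[/eqP <- vu]].
- have [ec|ce|->] := ltngtP e c; rewrite ?(ltn_trans ec cd)// ?cd// coef_le2//.
- by case: ifP => // _; case: ifP => // _; exact: ih.
Qed.

(** When [v] precedes [u], some ancestor-or-self of [v] lies at most one level
    below the last common ancestor of [u] and [v] and counts more for [u]. *)
Lemma coef_gap v u : before v u -> exists j m,
  [/\ (j <= size v)%N, (j <= size u)%N, take j v = take j u, (m <= j.+1)%N &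
      (m <= size v)%N /\ (coef v (take m v) < coef u (take m v))%N].
Proof.
elim: v u => [|c v ih] [|d u] //=; first by exists 0%N, 0%N.
move=> /orP[cd|/andP[/eqP <- /ih[j [m [jv ju e mj [mv h]]]]]].
  exists 0%N, 1%N; split => //; split => //=.
  by rewrite ltnn eqxx cd take0; case: v {ih}.
exists j.+1, m.+1; split => //=; first by rewrite e.
by rewrite ltnn eqxx.
Qed.

Section tree_curve.
Variables (R : realType) (N : nat) (nets : nat -> seq 'rV[R]_N).
Variables (par : nat -> 'rV[R]_N -> 'rV[R]_N) (x0 : 'rV[R]_N).
Variables (r0 rho s W : R).
Let r k := r0 * rho ^+ k.
Hypothesis r0_gt0 : 0 < r0.
Hypothesis rho_gt0 : 0 < rho.
Hypothesis rho_le : rho <= 2^-1.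
Hypothesis s_ge1 : 1 <= s.
Hypothesis nets0 : nets 0%N = [:: x0].
Hypothesis parP : forall k z, z \in nets k.+1 ->
  par k z \in nets k /\ enorm (z - par k z) <= r k.
Hypothesis sumW : forall n, \sum_(k < n) (size (nets k))%:R * r k `^ s <= W.

Let r_gt0 k : 0 < r k. Proof. by rewrite mulr_gt0// exprn_gt0. Qed.

Let rS k : r k.+1 = rho * r k. Proof. by rewrite /r exprS mulrCA. Qed.

Let s_gt0 : 0 < s. Proof. exact: lt_le_trans s_ge1. Qed.

(** The address of the point [z] of level [k]: at each level, the rank of the
    point in its whole level serves as child index. *)
Fixpoint addr k z : seq nat :=
  if k is k'.+1 then rcons (addr k' (par k' z)) (index z (nets k)) else [::].

Lemma size_addr k z : size (addr k z) = k.
Proof. by elim: k z => //= k ih z; rewrite size_rcons ih. Qed.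

Lemma addr_inj k z z' : z \in nets k -> z' \in nets k ->
  addr k z = addr k z' -> z = z'.
Proof.
case: k => [|k]; first by rewrite nets0 !inE => /eqP -> /eqP ->.
move=> zk z'k /= /rcons_inj[_ e].
by rewrite -(nth_index 0 zk) e nth_index.
Qed.

(** The ancestor at level [j] of a level [k] node. *)
Lemma ancestor k z j : z \in nets k -> (j <= k)%N -> exists y,
  [/\ y \in nets j, addr j y = take j (addr k z) & enorm (z - y) <= 2 * r j - 2 * r k].
Proof.
elim: k z => [|k ih] z zk.
  rewrite leqn0 => /eqP ->; exists z; split => //.
  by rewrite !subrr enorm0.
rewrite leq_eqVlt => /predU1P[->|]; first exists z.
  by rewrite take_oversize ?size_addr// !subrr enorm0.
rewrite ltnS => jk; have [pk pd] := parP zk.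
have [y [yj ya yd]] := ih _ pk jk.
exists y; split => //=.
  by rewrite ya -cats1 takel_cat// size_addr.
have := enorm_triangle (par k z) z y.
have : r k.+1 <= 2^-1 * r k by rewrite rS ler_wpM2r// ltW.
lra.
Qed.

(** The node [y] of level [k] has weight [r k `^ s], and is counted [coef] times
    in the time at which [u] is visited; [part u n] stops at level [n]. *)
Let part (u : seq nat) n :=
  \sum_(k < n) \sum_(y <- nets k) (coef u (addr k y))%:R * r k `^ s.

Let part_mono u n m : (n <= m)%N -> part u n <= part u m.
Proof.
move=> nm; rewrite /part -!(big_mkord xpredT
  (fun k => \sum_(y <- nets k) (coef u (addr k y))%:R * r k `^ s)).
rewrite [leRHS](@big_cat_nat _ _ _ n)//= lerDl sumr_ge0// => k _.
by rewrite sumr_ge0// => y _; rewrite mulr_ge0// powR_ge0.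
Qed.

Let part_le u n : part u n <= 2 * W.
Proof.
apply: (@le_trans _ _ (2 * \sum_(k < n) (size (nets k))%:R * r k `^ s)); last first.
  by rewrite ler_pM2l.
rewrite mulr_sumr; apply: ler_sum => k _.
apply: (@le_trans _ _ (\sum_(y <- nets k) 2 * r k `^ s)).
  by apply: ler_sum => y _; rewrite ler_wpM2r ?powR_ge0// ler_nat coef_le2.
by rewrite big_const_seq count_predT iter_addr_0 -[leLHS]mulr_natl mulrCA.
Qed.

(** The time at which the curve visits the node of address [u]. *)
Let time u := sup [set part u n | n in [set: nat]].

Let has_sup_part u : has_sup [set part u n | n in [set: nat]].
Proof.
split; first by exists (part u 0%N), 0%N.
by exists (2 * W) => _ [n _ <-]; exact: part_le.
Qed.

Let time_ge0 u : 0 <= time u.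
Proof.
apply: (@le_trans _ _ (part u 0%N)); first by rewrite /part big_ord0.
by apply: ub_le_sup; [exact: (has_sup_part u).2|exists 0%N].
Qed.

Let time_le u : time u <= 2 * W.
Proof.
by apply: ge_sup; [exact: (has_sup_part u).1|move=> _ [n _ <-]; exact: part_le].
Qed.

(* The weights of all nodes other than [y] compare in the right direction by
   [coef_before]. *)
Let time_gap u v m y : before v u -> y \in nets m ->
  (coef v (addr m y) < coef u (addr m y))%N -> time v + r m `^ s <= time u.
Proof.
move=> vu ym h; rewrite -lerBrDr; apply: ge_sup; first exact: (has_sup_part v).1.
move=> _ [n _ <-]; rewrite lerBrDr.
pose n' := maxn n m.+1.
apply: (@le_trans _ _ (part u n')); last first.
  by apply: ub_le_sup; [exact: (has_sup_part u).2|exists n'].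
apply: (@le_trans _ _ (part v n' + r m `^ s)).
  by rewrite lerD2r; apply: part_mono; rewrite leq_maxl.
have mn : (m < n')%N by rewrite leq_maxr.
rewrite /part (bigD1 (Ordinal mn))//= [leRHS](bigD1 (Ordinal mn))//=.
rewrite addrAC; apply: lerD; last first.
  apply: ler_sum => k _; apply: ler_sum => z _.
  by rewrite ler_wpM2r ?powR_ge0// ler_nat coef_before.
rewrite !(big_rem _ ym)/= addrAC; apply: lerD; last first.
  by apply: ler_sum => z _; rewrite ler_wpM2r ?powR_ge0// ler_nat coef_before.
by rewrite -[X in _ + X]mul1r -mulrDl ler_wpM2r ?powR_ge0// natr1 ler_nat.
Qed.

Let node := {p : nat * 'rV[R]_N | p.2 \in nets p.1}.
Let pos (u : node) : 'rV[R]_N := (val u).2.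
Let nt (u : node) : R := time (addr (val u).1 (val u).2).

(** Two nodes with last common ancestor at level [j] are at most [4 * r j]
    apart, and their times differ by at least the weight [r j.+1 `^ s]. *)
Let node_holder_before (u v : node) :
  before (addr (val v).1 (val v).2) (addr (val u).1 (val u).2) ->
  enorm (pos u - pos v) <= 4 / rho * `|nt u - nt v| `^ s^-1.
Proof.
case: u v => [[k z] /= zk] [[l y] /= yl] vu; rewrite /pos /nt /=.
have [j [m []]] := coef_gap vu; rewrite !size_addr => jl jk e mj [ml lt].
have [a [am aa _]] := ancestor yl ml; rewrite -aa in lt.
have gap := time_gap vu am lt.
have [b [bj ba bd]] := ancestor yl jl.
have [c [cj ca cd]] := ancestor zk jk.
have bc : b = c by apply: (addr_inj bj cj); rewrite ba ca.
have dist : enorm (z - y) <= 4 * r j.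
  have := enorm_triangle b z y; rewrite (enormC b y) bc.
  rewrite bc in bd; have := r_gt0 k; have := r_gt0 l; lra.
rewrite (le_trans dist)// -[leRHS]mulrA ler_pM2l// ler_pdivlMl// -rS.
have rm : r j.+1 <= r m.
  have rho1 : rho <= 1 by rewrite (le_trans rho_le)// invf_le1// ler1n.
  by rewrite /r ler_pM2l// ler_wiXn2l// ltW.
rewrite (le_trans rm)//.
rewrite [leLHS](_ : _ = (r m `^ s) `^ s^-1); last first.
  by rewrite -powRrM mulfV ?gt_eqF// powRr1 ?ltW.
apply: ge0_ler_powR; rewrite ?nnegrE ?powR_ge0 ?invr_ge0 ?(ltW s_gt0)//.
rewrite ler_normr; apply/orP; left; lra.
Qed.

Let node_holder (u v : node) :
  enorm (pos u - pos v) <= 4 / rho * `|nt u - nt v| `^ s^-1.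
Proof.
have [e|/before_total /orP[|]] := eqVneq (addr (val v).1 (val v).2)
    (addr (val u).1 (val u).2); last 2 first.
- exact: node_holder_before.
- by rewrite enormC distrC; exact: node_holder_before.
have -> : pos u = pos v.
  case: u v e => [[k z] /= zk] [[l y] /= yl] e.
  have kl : l = k by rewrite -(size_addr l y) e size_addr.
  rewrite /pos /=; move: yl e; rewrite {}kl => yl e.
  by rewrite (addr_inj yl zk e).
rewrite subrr enorm0 mulr_ge0 ?powR_ge0// divr_ge0// ltW//.
Qed.

(** If the nodes of a tree with geometrically shrinking edges satisfy
    [\sum r ^ s < oo], then a single [1/s]-Hoelder curve passes through all
    its nodes, hence through all its boundary points. *)
Lemma tree_holder_curve : exists G, holder_curve s G /\
  forall z, (forall k, exists2 x, x \in nets k & enorm (z - x) <= r k) -> G z.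
Proof.
have x0n : (0%N, x0).2 \in nets (0%N, x0).1 by rewrite /= nets0 inE.
pose root : node := exist _ (0%N, x0) x0n.
have s1 : 0 < s^-1 <= 1 by rewrite invr_gt0 s_gt0 invf_le1.
have H0 : 0 <= 4 / rho by rewrite divr_ge0// ltW.
have [f [fP fH]] := holder_extension root H0 s1 node_holder.
have W0 : 0 <= W by have := sumW 0%N; rewrite big_ord0.
(* All times lie in [[0, c]], which is rescaled to [[0, 1]]. *)
pose c := 2 * W + 1; have c0 : 0 < c by rewrite /c; lra.
pose g a := f (c * a).
pose K := N%:R * (4 / rho) * c `^ s^-1.
have K0 : 0 <= K by rewrite !mulr_ge0 ?powR_ge0// invr_ge0 ltW.
have gH a b : enorm (g a - g b) <= K * `|a - b| `^ s^-1.
  rewrite (le_trans (fH _ _))// -mulrBr normrM (gtr0_norm c0).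
  by rewrite powRM// ?(ltW c0)// mulrA.
exists (g @` `[0, 1]); split.
  by exists g, K; split => // x y _ _.
move=> z zP.
have gc : continuous g := holder_continuous K0 (andP s1).1 gH.
(* Boundary points are limits of nodes, and the curve is compact. *)
have cG : closed (g @` `[0, 1]).
  apply: compact_closed; first exact: norm_hausdorff.
  apply: continuous_compact; last exact: segment_compact.
  exact: continuous_subspaceT.
apply: cG => B /nbhs_ballP[e /= e0 eB].
have [k rk] : exists k, r k < e.
  have /cvgrPdist_lt /(_ (e / r0)) : (GRing.exp rho : R^nat) @ \oo --> (0 : R).
    by apply: cvg_expr; rewrite gtr0_norm// (le_lt_trans rho_le)// invf_lt1// ltr1n.
  move=> /(_ (divr_gt0 e0 r0_gt0))[k _ /(_ k (leqnn _))] /=.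
  rewrite sub0r normrN gtr0_norm ?exprn_gt0// => h; exists k.
  by rewrite /r mulrC -ltr_pdivlMr.
have [x xk xz] := zP k.
exists x; split.
  pose u : node := exist _ (k, x) xk.
  exists (nt u / c); last by rewrite /g mulrC divfK ?gt_eqF// fP.
  rewrite /= in_itv/= divr_ge0 ?(ltW c0)//=; last exact: time_ge0.
  by rewrite ler_pdivrMr// mul1r /c (le_trans (time_le _))// lerDl.
apply: eB; split => // i j; rewrite /ball /= ord1.
have := enorm_coord (z - x) j; rewrite !mxE => h.
by apply: le_lt_trans h (le_lt_trans xz rk).
Qed.

End tree_curve.

(** * Separated sets *)

Section separated.
Variables (R : realType) (N : nat).
Implicit Types (x y z : 'rV[R]_N) (r : R) (s : seq 'rV[R]_N).

(** [s] lists, without repetition, points at mutual distance at least [r]. *)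
Definition separated r s : Prop :=
  uniq s /\ {in s &, forall x y, x != y -> r <= enorm (x - y)}.

Lemma separated_filter r s (P : pred 'rV[R]_N) :
  separated r s -> separated r [seq x <- s | P x].
Proof.
move=> [us ss]; split; first exact: filter_uniq.
by move=> x y; rewrite !mem_filter => /andP[_ xs] /andP[_ ys]; exact: ss.
Qed.

Lemma uniq_size_le (F : finType) (T : eqType) (l : seq T) (f : T -> F) :
  uniq l -> {in l &, injective f} -> (size l <= #|F|)%N.
Proof.
move=> ul fi; have fu : uniq (map f l) by rewrite map_inj_in_uniq.
by rewrite -(size_map f) -(card_uniqP fu) max_card.
Qed.

Lemma truncn_eq_lt1 (a b : R) : 0 <= a -> 0 <= b ->
  Num.truncn a = Num.truncn b -> `|a - b| < 1.
Proof.
move=> /truncn_itv/andP[a1 a2] /truncn_itv/andP[b1 b2] e.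
rewrite e in a1 a2; rewrite -natr1 in a2; rewrite -natr1 in b2.
rewrite ltr_norml; lra.
Qed.

(** Separated points in a ball are injected into a grid of comparable mesh. *)
Lemma separated_ball_size (lam : R) : exists K : nat, forall r x s, 0 < r ->
  separated r s -> (forall z, z \in s -> enorm (z - x) <= lam * r) ->
  (size s <= K)%N.
Proof.
pose n : R := N.+1%:R; have n0 : 0 < n by rewrite ltr0n.
pose M := Num.truncn (2 * lam * n).
exists #|{ffun 'I_N -> 'I_M.+1}| => r x s r0 [us ss] sx.
pose c z (i : 'I_N) := (z 0 i - x 0 i) / r * n + lam * n.
have cM z i : z \in s -> 0 <= c z i <= 2 * lam * n.
  move=> zs; have := enorm_coord (z - x) i; rewrite !mxE => /le_trans/(_ (sx _ zs)).
  rewrite ler_norml => /andP[h1 h2].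
  have h3 : - lam <= (z 0 i - x 0 i) / r by rewrite ler_pdivlMr// mulNr.
  have h4 : (z 0 i - x 0 i) / r <= lam by rewrite ler_pdivrMr.
  have := ler_wpM2r (ltW n0) h3; have := ler_wpM2r (ltW n0) h4.
  rewrite /c; lra.
pose f z : {ffun 'I_N -> 'I_M.+1} := [ffun i => inord (Num.truncn (c z i))].
apply: (@uniq_size_le _ _ _ f) => // y z ys zs /ffunP yz.
apply/eqP/negP => /negP yNz.
have := ss _ _ ys zs yNz; apply/negP; rewrite -ltNge.
apply: (@le_lt_trans _ _ (N%:R * (r / n))); last first.
  by rewrite mulrCA gtr_pMr// ltr_pdivrMr// mul1r ltr_nat.
apply: enorm_le_coord; first by rewrite divr_ge0// ltW.
move=> i; rewrite !mxE; have := yz i; rewrite !ffunE => /(congr1 val) /=.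
have le w : w \in s -> (Num.truncn (c w i) < M.+1)%N.
  by move=> ws; rewrite ltnS; apply: le_truncn; case/andP: (cM w i ws).
rewrite !inordK ?le// => /truncn_eq_lt1.
have /andP[-> _] := cM y i ys; have /andP[-> _] := cM z i zs => /(_ isT isT).
rewrite /c opprD addrACA subrr addr0 -mulrBl -mulrBl opprB addrA subrK.
rewrite !normrM normfV (gtr0_norm r0) (gtr0_norm n0) => h.
by rewrite ler_pdivlMr// ltW// -[ltRHS]mul1r -ltr_pdivrMr// mulrAC.
Qed.

(** Near a line only linearly many separated points fit. *)
Lemma separated_line_size (lam : R) r x (L : set 'rV[R]_N) s : 0 <= lam ->
  0 < r -> separated r s -> is_line L ->
  (forall z, z \in s -> enorm (z - x) <= lam * r) ->
  (forall z, z \in s -> exists2 y, L y & enorm (z - y) <= r / 4) ->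
  (size s)%:R <= 8 * lam + 3.
Proof.
move=> lam0 r0 [us ss] [a [v [v0 ->]]] sx sL.
case: s us ss sx sL => [|z0 s'] us ss sx sL; first by rewrite /=; lra.
set s := z0 :: s' in us ss sx sL *.
have /choice[t tP] z : exists t : R, z \in s -> enorm (z - (a + t *: v)) <= r / 4.
  have [/sL[y [t _ <-] ty]|zs] := boolP (z \in s); first by exists t.
  by exists 0.
(* The coordinate along the line is [r / 2]-separated on [s]. *)
pose tau z := t z * enorm v.
have tauB y z : `|tau y - tau z| = enorm ((a + t y *: v) - (a + t z *: v)).
  rewrite /tau -mulrBl normrM (ger0_norm (enorm_ge0 _)) -enormZ scalerBl.
  by congr enorm; rewrite opprD addrACA subrr add0r.
pose c z := (tau z - tau z0) / (r / 2) + (4 * lam + 1).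
have r20 : 0 < r / 2 by lra.
have z0s : z0 \in s by rewrite inE eqxx.
have cM z : z \in s -> 0 <= c z <= 8 * lam + 2.
  move=> zs; have : `|tau z - tau z0| <= (4 * lam + 1) * (r / 2).
    rewrite tauB; set p := a + _; set q := a + _.
    have := enorm_triangle z p q; have := enorm_triangle x z q.
    have := enorm_triangle z0 x q; have := tP z zs; have := tP z0 z0s.
    rewrite -/p -/q (enormC p z) (enormC x z0).
    have := sx z zs; have := sx z0 z0s; lra.
  rewrite ler_norml => /andP[h1 h2].
  have h3 : - (4 * lam + 1) <= (tau z - tau z0) / (r / 2).
    by rewrite ler_pdivlMr// mulNr.
  have h4 : (tau z - tau z0) / (r / 2) <= 4 * lam + 1 by rewrite ler_pdivrMr.
  by rewrite /c; lra.
pose M := Num.truncn (8 * lam + 2).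
have le w : w \in s -> (Num.truncn (c w) < M.+1)%N.
  by move=> ws; rewrite ltnS; apply: le_truncn; case/andP: (cM w ws).
pose f z : 'I_M.+1 := inord (Num.truncn (c z)).
have : (size s <= #|'I_M.+1|)%N.
  apply: (@uniq_size_le _ _ _ f) => // y z ys zs /(congr1 val) /=.
  rewrite !inordK ?le// => /truncn_eq_lt1.
  have /andP[-> _] := cM y ys; have /andP[-> _] := cM z zs => /(_ isT isT).
  rewrite /c opprD addrACA subrr addr0 -mulrBl opprB addrA subrK.
  rewrite normrM normfV (gtr0_norm r20) ltr_pdivrMr// mul1r tauB.
  set p := a + _; set q := a + _ => h; apply/eqP/negP => /negP yNz.
  have := ss _ _ ys zs yNz; have := enorm_triangle p y z.
  have := enorm_triangle q p z; have := tP y ys; have := tP z zs.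
  rewrite -/p -/q (enormC z q); lra.
rewrite card_ord -(ler_nat R) -natr1 => /le_trans; apply.
have /truncn_itv/andP[+ _] : 0 <= 8 * lam + 2 by lra.
rewrite -/M; lra.
Qed.

(** Bounded sets have finite maximal separated subsets. *)
Lemma maximal_separated (X : set 'rV[R]_N) x (d r : R) : 0 < r ->
  (forall z, X z -> enorm (z - x) <= d) ->
  exists s, [/\ separated r s, (forall z, z \in s -> X z) &
    forall z, X z -> exists2 y, y \in s & enorm (z - y) < r].
Proof.
move=> r0 Xd.
pose P n := `[< exists s, [/\ separated r s, (forall z, z \in s -> X z) &
  size s = n] >].
have P0 : exists n, P n by exists 0%N; apply/asboolP; exists [::]; split.
have [K KP] := separated_ball_size (d / r).
have Pub n : P n -> (n <= K)%N.
  move=> /asboolP[s [ss sX <-]]; apply: (KP r x) => // z /sX /Xd h.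
  by rewrite divfK ?gt_eqF.
(* A list of maximal length cannot be extended, so it is maximal. *)
case: (ex_maxnP P0 Pub) => n /asboolP[s [[us ss] sX sn]] maxn.
exists s; split => // z Xz; apply: contrapT => h.
have far y : y \in s -> r <= enorm (z - y).
  by move=> ys; rewrite leNgt; apply/negP => zy; apply: h; exists y.
have zs : z \notin s.
  by apply/negP => /far; rewrite subrr enorm0; lra.
suff : (n.+1 <= n)%N by rewrite ltnn.
apply: maxn; apply/asboolP; exists (z :: s); split => /=.
- split=> /=; first by rewrite zs.
  move=> p q; rewrite !inE => /predU1P[->|ps] /predU1P[->|qs]; rewrite ?eqxx//.
  + by move=> _; exact: far.
  + by move=> _; rewrite enormC; exact: far.
  + exact: ss.
- by move=> y; rewrite inE => /predU1P[->//|]; exact: sX.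
- by rewrite sn.
Qed.

End separated.

(** * Curves through sets with few nonflat balls *)

Section traveling_salesman.
Variables (R : realType) (N : nat).

(** [E] is [eps * r]-close to a line inside the ball of center [x] and radius
    [r]. *)
Definition flat (E : set 'rV[R]_N) (eps : R) (x : 'rV[R]_N) (r : R) : Prop :=
  exists2 L, is_line L &
    forall z, E z -> enorm (z - x) <= r -> exists2 y, L y & enorm (z - y) <= eps * r.

Lemma size_le_fibers (T : eqType) (s t : seq T) (f : T -> T) :
  (forall z, z \in s -> f z \in t) ->
  (size s <= \sum_(x <- t) size [seq z <- s | f z == x])%N.
Proof.
move=> st; rewrite -sum1_size.
under [leqRHS]eq_bigr do rewrite size_filter -sum1_count.
rewrite (exchange_big_dep xpredT)//= big_seq [leqRHS]big_seq.
apply: leq_sum => z zs.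
rewrite sum1_count -has_count; apply/hasP; exists (f z) => //; exact: st.
Qed.

Variables (E : set 'rV[R]_N) (x0 : 'rV[R]_N) (r0 rho s C : R).
Let r k := r0 * rho ^+ k.
Hypothesis r0_gt0 : 0 < r0.
Hypothesis rho_gt0 : 0 < rho.
Hypothesis rho_le : rho <= 2^-1.
Hypothesis s_ge1 : 1 <= s.
Hypothesis rho_small : (8 / rho + 3) * rho `^ s <= 2^-1.
Hypothesis Ex0 : E x0.
Hypothesis Er0 : forall z, E z -> enorm (z - x0) <= r0.
Hypothesis nonflat_sum : forall (nets : nat -> seq 'rV[R]_N) n,
  (forall k, separated (r k) (nets k)) ->
  (forall k x, x \in nets k -> E x) ->
  \sum_(k < n) \sum_(x <- nets k | `[< ~ flat E (rho / 4) x (r k) >]) r k `^ s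
    <= C.

(** If the nonflat balls of every choice of separated nets of [E] have bounded
    total [s]-content, then [E] lies on a [1/s]-Hoelder curve: below a flat
    ball, the [O(1/rho)] balls of the next generation have at most half the
    [s]-content of their parent, since [rho ^ (s - 1)] is small. *)
Lemma summable_nonflat_holder_curve : exists2 G, holder_curve s G & E `<=` G.
Proof.
have r_gt0 k : 0 < r k by rewrite mulr_gt0// exprn_gt0.
have rS k : r k.+1 = rho * r k by rewrite /r exprS mulrCA.
(* The tree has for nodes the points of maximal [r k]-separated nets. *)
have /choice[nets netsP] k : exists t : seq 'rV[R]_N,
    [/\ separated (r k) t, (forall z, z \in t -> E z),
      (forall z, E z -> exists2 y, y \in t & enorm (z - y) <= r k) &
      k = 0%N -> t = [:: x0]].
  case: k => [|k].
    exists [:: x0]; split => //.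
    - by split => // x y; rewrite !inE => /eqP-> /eqP->; rewrite eqxx.
    - by move=> z; rewrite inE => /eqP->.
    - move=> z Ez; exists x0; rewrite ?inE//.
      by rewrite /r expr0 mulr1; exact: Er0.
  have [t [h1 h2 h3]] := maximal_separated (r_gt0 k.+1) Er0.
  exists t; split => // z /h3[y yt h]; exists y => //; exact: ltW.
have /choice[par parP] k : exists f : 'rV[R]_N -> 'rV[R]_N, forall z, E z ->
    f z \in nets k /\ enorm (z - f z) <= r k.
  suff /choice[f fP] : forall z, exists y, E z -> y \in nets k /\ enorm (z - y) <= r k.
    by exists f.
  move=> z; have [Ez|nEz] := pselect (E z); last by exists 0.
  by have [_ _ /(_ z Ez)[y yk zy] _] := netsP k; exists y.
have netE k z : z \in nets k -> E z by have [_ h _ _] := netsP k; exact: h.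
have [K KP] := separated_ball_size N rho^-1.
pose bad k x := `[< ~ flat E (rho / 4) x (r k) >].
pose S k : R := (size (nets k))%:R * r k `^ s.
pose K' : R := K%:R * rho `^ s.
have K'0 : 0 <= K' by rewrite mulr_ge0// powR_ge0.
have rlam k : rho^-1 * r k.+1 = r k by rewrite rS mulKf// gt_eqF.
(* Flat parents contribute to the first term, nonflat ones to the second. *)
have SS k : S k.+1 <= 2^-1 * S k + K' * \sum_(x <- nets k | bad k x) r k `^ s.
  pose ch x := [seq z <- nets k.+1 | par k z == x].
  have sch x : separated (r k.+1) (ch x).
    by apply: separated_filter; case: (netsP k.+1).
  have dch x z : z \in ch x -> E z /\ enorm (z - x) <= rho^-1 * r k.+1.
    rewrite mem_filter => /andP[/eqP <- zk]; have Ez := netE _ _ zk.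
    by split => //; rewrite rlam; exact: (parP _ _ Ez).2.
  have -> : S k.+1 = rho `^ s * r k `^ s * (size (nets k.+1))%:R.
    by rewrite /S rS powRM ?(ltW rho_gt0)// ?(ltW (r_gt0 _))// mulrC.
  have ps0 : 0 <= rho `^ s * r k `^ s by rewrite mulr_ge0// powR_ge0.
  apply: (@le_trans _ _ (rho `^ s * r k `^ s * \sum_(x <- nets k) (size (ch x))%:R)).
    rewrite ler_wpM2l// -natr_sum ler_nat; apply: size_le_fibers => z zk.
    by have [] := parP k z (netE _ _ zk).
  rewrite /S -sum1_size natr_sum [X in 2^-1 * X]mulrC !mulr_sumr [X in _ + X]big_mkcond/=.
  rewrite -big_split/=; apply: ler_sum => x _.
  rewrite mulr1; case: ifPn => xbad.
    apply: (@le_trans _ _ (K' * r k `^ s)); last first.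
      by rewrite lerDr mulr_ge0// powR_ge0.
    rewrite /K' mulrC -mulrA ler_wpM2r// ler_nat.
    by apply: (KP (r k.+1) x) => // z /dch[].
  rewrite addr0 mulrAC ler_wpM2r ?powR_ge0// mulrC.
  apply: le_trans rho_small; rewrite ler_wpM2r ?powR_ge0//.
  move/asboolPn : xbad => /contrapT[L Ll LP].
  apply: (@separated_line_size _ _ rho^-1 (r k.+1) x L) => //.
  - by rewrite invr_ge0 ltW.
  - by move=> z /dch[].
  - move=> z /dch[Ez]; rewrite rlam => zx.
    have [y Ly h] := LP z Ez zx; exists y => //.
    by rewrite (le_trans h)// rS mulrAC.
have C0 : 0 <= C.
  have := @nonflat_sum (fun=> [::]) 0%N; rewrite big_ord0; apply => //.
have SW n : \sum_(k < n) S k <= 2 * (S 0%N + K' * C).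
  elim: n => [|n ih].
    by rewrite big_ord0 mulr_ge0// addr_ge0 ?mulr_ge0// powR_ge0.
  rewrite big_ord_recl.
  have : \sum_(i < n) S (lift ord0 i) <= \sum_(k < n)
      (2^-1 * S k + K' * \sum_(x <- nets k | bad k x) r k `^ s).
    by apply: ler_sum => i _; rewrite lift0; exact: SS.
  rewrite big_split/= -!mulr_sumr.
  have : K' * \sum_(k < n) \sum_(x <- nets k | bad k x) r k `^ s <= K' * C.
    rewrite ler_wpM2l//; apply: nonflat_sum => // k.
    by case: (netsP k).
  lra.
have nets0 : nets 0%N = [:: x0] by have [_ _ _ ->] := netsP 0%N.
have parP' k z : z \in nets k.+1 -> par k z \in nets k /\ enorm (z - par k z) <= r k.
  by move=> zk; apply: parP; exact: netE zk.
have [G [hG GP]] := tree_holder_curve r0_gt0 rho_gt0 rho_le s_ge1 nets0 parP' SW.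
exists G => // z Ez; apply: GP => k.
by have [_ _ h _] := netsP k; exact: h.
Qed.

End traveling_salesman.

(** * Outer measures: overlap and low density *)

Section overlap.
Local Open Scope ereal_scope.

(** Chebyshev's inequality for a weighted family of Caratheodory sets and an
    arbitrary, possibly nonmeasurable, set [X]. *)
Lemma weighted_overlap (R : realType) (T : Type)
    (mu : {outer_measure set T -> \bar R}) (I : Type) (l : seq I) (a : I -> R)
    (B : I -> set T) :
  (forall i, 0 <= a i)%R -> (forall i, mu.-caratheodory (B i)) ->
  forall (X : set T) (M : R), (0 <= M)%R ->
  (forall y, X y -> (\sum_(i <- l) a i * \1_(B i) y <= M)%R) ->
  \sum_(i <- l) (a i)%:E * mu (X `&` B i) <= M%:E * mu X.
Proof.
move=> a0 mB; (* Induction on the family, splitting [X] along its first member. *)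
elim: l => [|i l ih] X M M0 XM.
  by rewrite big_nil mule_ge0// outer_measure_ge0.
rewrite big_cons.
have dec j : (a j)%:E * mu (X `&` B j) =
    (a j)%:E * mu ((X `&` B i) `&` B j) + (a j)%:E * mu ((X `&` ~` B i) `&` B j).
  rewrite (mB i (X `&` B j)) ge0_muleDr ?outer_measure_ge0//.
  by rewrite (setIAC X (B j) (B i)) (setIAC X (B j) (~` B i)).
rewrite (eq_bigr _ (fun j _ => dec j)) big_split/= (mB i X).
rewrite ge0_muleDr ?outer_measure_ge0//.
rewrite addeA leeD//; last first.
  apply: ih => // y [Xy /= nBi]; have := XM y Xy.
  by rewrite big_cons indicE memNset// mulr0 add0r.
have [[y0 [Xy0 By0]]|XB0] := pselect (X `&` B i !=set0); last first.
  rewrite (_ : X `&` B i = set0); last first.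
    by apply/seteqP; split => // y Xy; apply: XB0; exists y.
  by rewrite outer_measure0 !mule0 add0e big1// => j _; rewrite set0I outer_measure0 mule0.
have Ma y : (X `&` B i) y -> (\sum_(j <- l) a j * \1_(B j) y <= M - a i)%R.
  move=> [Xy By]; have := XM y Xy; rewrite big_cons indicE mem_set// mulr1; lra.
have Ma0 : (0 <= M - a i)%R.
  apply: le_trans (Ma y0 (conj Xy0 By0)); apply: sumr_ge0 => j _.
  by rewrite mulr_ge0// indicE ler0n.
rewrite [in leRHS](_ : M = a i + (M - a i))%R; last by rewrite addrCA subrr addr0.
by rewrite EFinD ge0_muleDl ?lee_fin// leeD2l// ih.
Qed.

Lemma sum_indic_at_most_one (R : realType) (T : Type) (I : eqType) (l : seq I)
    (c : I -> R) (B : I -> set T) (y : T) : uniq l ->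
  {in l &, forall i j, B i y -> B j y -> i = j} ->
  (\sum_(i <- l) c i * \1_(B i) y = 0)%R \/
  exists2 i, i \in l & B i y /\ (\sum_(i <- l) c i * \1_(B i) y = c i)%R.
Proof.
move=> ul h; have [[i [il iy]]|n] := pselect (exists i, i \in l /\ B i y).
  right; exists i => //; split => //.
  rewrite (bigD1_seq i)//= indicE mem_set// mulr1 big_seq_cond big1 ?addr0//.
  move=> j /andP[jl ji]; rewrite indicE memNset ?mulr0// => jy.
  by move: ji; rewrite (h j i)// eqxx.
left; rewrite big_seq big1// => i il; rewrite indicE memNset ?mulr0// => iy.
by apply: n; exists i.
Qed.

Lemma disjoint_sum_le (R : realType) (T : Type)
    (mu : {outer_measure set T -> \bar R}) (I : eqType) (l : seq I)
    (B : I -> set T) (X : set T) : uniq l ->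
  (forall i, mu.-caratheodory (B i)) ->
  {in l, forall i, B i `<=` X} ->
  {in l &, forall i j y, B i y -> B j y -> i = j} ->
  \sum_(i <- l) mu (B i) <= mu X.
Proof.
move=> ul mB BX h.
apply: (@le_trans _ _ (1%:E * mu X)); last by rewrite mul1e.
apply: le_trans (weighted_overlap (l := l) (a := fun=> 1%R) _ mB _ _) => //.
  rewrite big_seq [leRHS]big_seq; apply: lee_sum => i il.
  by rewrite mul1e setIidr//; exact: BX.
move=> y _; have hy : {in l &, forall i j, B i y -> B j y -> i = j}.
  by move=> i j il jl; exact: h.
by have [->|[i _ [_ ->]]] := @sum_indic_at_most_one R _ _ l (fun=> 1%R) B y ul hy.
Qed.

Lemma outer_measure_null_bigcup (R : realType) (T : Type)
    (mu : {outer_measure set T -> \bar R}) (F : (set T)^nat) :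
  (forall n, mu (F n) = 0) -> mu (\bigcup_n F n) = 0.
Proof.
move=> F0; apply/eqP; rewrite eq_le outer_measure_ge0 andbT.
by rewrite (le_trans (outer_measure_sigma_subadditive mu F))// eseries0.
Qed.

Lemma outer_measure_list_union (R : realType) (T : Type)
    (mu : {outer_measure set T -> \bar R}) (I : eqType) (l : seq I)
    (F : I -> set T) :
  mu [set z | exists2 i, i \in l & F i z] <= \sum_(i <- l) mu (F i).
Proof.
elim: l => [|i l ih].
  rewrite big_nil (_ : [set z | _] = set0) ?outer_measure0//.
  by apply/seteqP; split => // z [].
rewrite big_cons; apply: le_trans (leeD2l _ ih).
apply: le_trans (outer_measureU2 _ _ _); apply: le_outer_measure.
move=> z [j]; rewrite inE => /predU1P[->|jl] Fz; [by left|by right; exists j].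
Qed.

End overlap.

Section low_density.
Local Open Scope ereal_scope.
Variables (R : realType) (N : nat).
Variable mu : {outer_measure set 'rV[R]_N -> \bar R}.
Hypothesis mball : forall x r, mu.-caratheodory (eball x r).
Variables (A : set 'rV[R]_N) (x0 : 'rV[R]_N) (d kappa : R) (r : nat -> R).
Hypothesis Ad : forall z, A z -> (enorm (z - x0) <= d)%R.
Hypothesis r_gt0 : forall k, (0 < r k)%R.
Hypothesis r_noninc : forall j k, (j <= k)%N -> (r k <= r j)%R.
Hypothesis kappa_ge0 : (0 <= kappa)%R.

(** The points of [A] around which [A] has low density at scale [r k], and those
    whose [r k]-ball is moreover disjoint from the balls of the list [W] of
    centers and radii. *)
Let low k := [set x | A x /\
  mu (A `&` eball x (2 * r k)) <= kappa%:E * mu (eball x (r k))].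

Let free k (W : seq ('rV[R]_N * R)) := [set x | low k x /\
  forall p, p \in W -> (r k + p.2 <= enorm (x - p.1))%R].

(* [t] is a maximal [2 * r k]-separated list in [free k W]. *)
Let net k W (t : seq 'rV[R]_N) :=
  [/\ separated (2 * r k) t, (forall z, z \in t -> free k W z) &
    forall z, free k W z -> exists2 y, y \in t & (enorm (z - y) < 2 * r k)%R].

Let pick_ex : exists pick : nat -> seq ('rV[R]_N * R) -> seq 'rV[R]_N,
  forall k W, net k W (pick k W).
Proof.
have netW k W : exists t, net k W t.
  apply: (@maximal_separated _ _ _ x0 d); first by rewrite mulr_gt0.
  by move=> z [[Az _] _]; exact: Ad.
have /choice[f fP] k : exists f, forall W, net k W (f W).
  by have [f fP] := choice (netW k); exists f.
by exists f.
Qed.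

(** Vitali's covering argument, selecting disjoint balls greedily scale after
    scale: the points of [A] having, at some scale, a ball in which [A] has
    density at most [kappa] form a set of measure [O(kappa)]. *)
Lemma low_density_measure :
  mu (\bigcup_k low k) <= kappa%:E * mu (eball x0 (d + 2 * r 0%N)).
Proof.
have [pick pickP] := pick_ex.
(* [W k] lists the balls selected at the scales before [k]. *)
pose W := fix W k : seq ('rV[R]_N * R) :=
  if k is k'.+1 then W k' ++ [seq (y, r k') | y <- pick k' (W k')] else [::].
have WE k p : p \in W k.+1 ->
    p \in W k \/ exists2 y, y \in pick k (W k) & p = (y, r k).
  by rewrite /= mem_cat => /orP[|/mapP[y yp ->]]; [left|right; exists y].
have Wr k p : p \in W k -> [/\ A p.1, (r k <= p.2)%R & (0 < p.2 <= r 0%N)%R].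
  elim: k p => [//|k ih] p /WE[/ih[Ap rp ->]|[y yp ->/=]].
    by split => //; rewrite (le_trans _ rp)// r_noninc.
  have [_ /(_ y yp)[[Ay _] _] _] := pickP k (W k).
  by split => //; rewrite ?r_gt0/= r_noninc.
have Wsep k : uniq (W k) /\
    {in W k &, forall p q, p != q -> (p.2 + q.2 <= enorm (p.1 - q.1))%R}.
  elim: k => [//|k [uk sk]].
  have [[up sp] fp _] := pickP k (W k).
  have far p y : p \in W k -> y \in pick k (W k) ->
      (p.2 + r k <= enorm (p.1 - y))%R.
    by move=> pk /fp[_ /(_ p pk)]; rewrite enormC addrC.
  split.
    rewrite /= cat_uniq uk/= map_inj_uniq ?up ?andbT; last by move=> ? ? [].
    apply/hasPn => _ /mapP[y yp ->]; apply/negP => yW.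
    have := far _ _ yW yp; rewrite /= subrr enorm0.
    by have := r_gt0 k; lra.
  move=> p q /WE[pk|[y yp ->]] /WE[qk|[z zp ->]] pq /=.
  - exact: sk.
  - exact: far.
  - by rewrite enormC addrC; exact: far.
  - rewrite -mulr2n -mulr_natl; apply: sp => //.
    by apply: contra pq => /eqP ->.
pose Y k := [set z | exists2 y, y \in pick k (W k) & (A `&` eball y (2 * r k)) z].
have cover : \bigcup_k low k `<=` \bigcup_k Y k.
  move=> x [k _ lx]; have Ax : A x by case: lx.
  have [fx|nfx] := pselect (free k (W k) x).
    have [_ _ /(_ x fx)[y yp xy]] := pickP k (W k).
    by exists k => //; exists y.
  (* Otherwise the ball of [x] meets an earlier one, which is at least as large,
     so its double contains [x]. *)
  have [p pk xp] : exists2 p, p \in W k & (enorm (x - p.1) < r k + p.2)%R.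
    apply: contrapT => h; apply: nfx; split => // p pk.
    by rewrite leNgt; apply/negP => xp; apply: h; exists p.
  have [_ rp _] := Wr _ _ pk.
  have [j jk [y yp pE]] : exists2 j, (j < k)%N &
      exists2 y, y \in pick j (W j) & p = (y, r j).
    elim: (k) pk => [//|m ih] /WE[/ih[j jm h]|h]; last by exists m.
    by exists j => //; exact: ltnW.
  exists j => //; exists y => //; split => //.
  by move: xp rp; rewrite pE /eball/=; lra.
apply: (le_trans (le_outer_measure mu _ _ cover)).
apply: (le_trans (outer_measure_sigma_subadditive mu Y)).
apply: lime_le; first exact: is_cvg_nneseries.
near=> n; rewrite big_mkord.
apply: (@le_trans _ _ (\sum_(k < n) kappa%:E *
    \sum_(y <- pick k (W k)) mu (eball y (r k)))).
  apply: lee_sum => k _.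
  apply: (le_trans (outer_measure_list_union _ _ _)).
  rewrite ge0_sume_distrr// big_seq [leRHS]big_seq; apply: lee_sum => y yp.
  by have [_ /(_ y yp)[[_ ]]] := pickP k (W k).
rewrite -ge0_sume_distrr; last by move=> k _; exact: sume_ge0.
apply: lee_wpmul2l; first by rewrite lee_fin.
have -> : \sum_(k < n) \sum_(y <- pick k (W k)) mu (eball y (r k)) =
    \sum_(p <- W n) mu (eball p.1 p.2).
  elim: (n) => [|m ih]; first by rewrite big_ord0 big_nil.
  by rewrite big_ord_recr/= ih big_cat/= big_map.
have [uW sW] := Wsep n.
apply: (@disjoint_sum_le _ _ mu _ (W n) (fun p => eball p.1 p.2)) => //.
- move=> p pn; have [Ap _ /andP[_ pr]] := Wr _ _ pn.
  apply: sub_eball; have := Ad Ap; have := r_gt0 0%N; lra.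
- move=> p q pn qn y py qy; apply/eqP/negP => /negP pq.
  have := sW p q pn qn pq; have := enorm_triangle y p.1 q.1.
  by move: py qy; rewrite /eball/= (enormC p.1 y); lra.
Unshelve. all: by end_near. Qed.

End low_density.

(** * Flatness and beta numbers *)

Section lower_integral.
Local Open Scope ereal_scope.
Variables (d : measure_display) (T : measurableType d) (R : realType).
Variable m : {measure set T -> \bar R}.

(** Monotonicity without measurability: the integral of a nonnegative function
    is a supremum over the simple functions below it. *)
Lemma le_integral_nonmeasurable (D : set T) (f g : T -> \bar R) :
  (forall x, D x -> 0 <= g x) -> (forall x, D x -> g x <= f x) ->
  \int[m]_(x in D) g x <= \int[m]_(x in D) f x.
Proof.
move=> g0 gf.
have f0 x : D x -> 0 <= f x by move=> Dx; exact: le_trans (g0 x Dx) (gf x Dx).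
rewrite !ge0_integralE//; apply: le_ereal_sup => _ [h hg <-]; exists h => // x.
apply: le_trans (hg x) _; rewrite /patch; case: ifPn => // xD.
by apply: gf; rewrite inE in xD.
Qed.

(** The integral of a nonnegative, possibly nonmeasurable, function dominates
    that of any step function below it. *)
Lemma integral_ge_step (I : Type) (l : seq I) (D : set T) (F : I -> set T)
    (c : I -> R) (f : T -> \bar R) : measurable D ->
  (forall i, measurable (F i)) -> (forall i, F i `<=` D) ->
  (forall i, 0 <= c i)%R ->
  (forall x, D x -> (\sum_(i <- l) c i * \1_(F i) x)%:E <= f x) ->
  \sum_(i <- l) (c i)%:E * m (F i) <= \int[m]_(x in D) f x.
Proof.
move=> mD mF FD c0 cf; apply: le_trans (le_integral_nonmeasurable _ cf); last first.
  by move=> x _; rewrite lee_fin; apply: sumr_ge0 => i _; rewrite mulr_ge0.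
under eq_integral do rewrite -sumEFin.
rewrite ge0_integral_sum//; last 2 first.
- move=> i; apply/measurable_EFinP; apply: measurable_funM => //.
- by move=> i x _; rewrite lee_fin mulr_ge0.
apply: lee_sum => i _.
under eq_integral do rewrite EFinM.
rewrite ge0_integralZl_EFin//; last by apply/measurable_EFinP.
by rewrite integral_indic// setIidl.
Qed.

End lower_integral.

Section doubling.
Local Open Scope ereal_scope.
Variables (R : realType) (N : nat).
Variable mu : {outer_measure set 'rV[R]_N -> \bar R}.
Hypothesis mball : forall x r, mu.-caratheodory (eball x r).
Variables (A : set 'rV[R]_N) (rad D : R).
Hypothesis Apos : forall x r, A x -> (0 < r)%R -> 0 < mu (eball x r).
Hypothesis Afin : forall x, A x -> mu (eball x rad) < +oo.
Hypothesis Adbl : forall x r, A x -> (0 < r <= rad)%R ->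
  mu (eball x (2 * r)) <= D%:E * mu (eball x r).
Hypothesis D_ge1 : (1 <= D)%R.

(** Doubling by an arbitrary factor. *)
Lemma doubling_iter (lam : R) : (0 < lam)%R -> exists2 C : R, (0 < C)%R &
  forall x r, A x -> (0 < r)%R -> (lam * r <= rad)%R ->
    mu (eball x (lam * r)) <= C%:E * mu (eball x r).
Proof.
move=> lam0.
have D0 : (0 < D)%R by exact: lt_le_trans D_ge1.
have iter j x r : A x -> (0 < r <= rad)%R ->
    mu (eball x r) <= (D ^+ j)%:E * mu (eball x (r / 2 ^+ j)).
  move=> Ax /andP[r0 rr]; elim: j => [|j ih].
    by rewrite !expr0 divr1 mul1e.
  apply: (le_trans ih); rewrite exprSr EFinM -muleA.
  apply: lee_wpmul2l; first by rewrite lee_fin exprn_ge0// ltW.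
  have -> : (r / 2 ^+ j = 2 * (r / 2 ^+ j.+1))%R.
    by rewrite exprS invfM [RHS]mulrCA mulVKf.
  apply: Adbl => //; rewrite divr_gt0 ?exprn_gt0//=.
  rewrite ler_pdivrMr ?exprn_gt0// (le_trans rr)// ler_peMr//.
    by rewrite (le_trans _ rr)// ltW.
  by rewrite exprn_ege1// ler1n.
pose j := (Num.truncn lam).+1.
have lamj : (lam <= 2 ^+ j)%R.
  have /truncn_itv/andP[_ /ltW h] := ltW lam0.
  by rewrite (le_trans h)// -natrX ler_nat ltnW// ltn_expl.
exists (D ^+ j)%R; first by rewrite exprn_gt0.
move=> x r Ax r0 rr; have lr0 : (0 < lam * r)%R by rewrite mulr_gt0.
apply: (le_trans (iter j x (lam * r)%R Ax _)); first by rewrite lr0.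
apply: lee_wpmul2l; first by rewrite lee_fin exprn_ge0// ltW.
apply: le_outer_measure; apply: le_eball.
by rewrite mulrAC ler_piMl ?(ltW r0)// ler_pdivrMr ?mul1r// exprn_gt0.
Qed.

(** [mB x r] is the measure of a ball, as a real number. *)
Let mB x r : R := fine (mu (eball x r)).

Let mBE x r : A x -> (r <= rad)%R -> mu (eball x r) = (mB x r)%:E.
Proof.
move=> Ax rr; rewrite /mB fineK// ge0_fin_numE ?outer_measure_ge0//.
by apply: le_lt_trans (Afin Ax); apply: le_outer_measure; exact: le_eball.
Qed.

Let mB_gt0 x r : A x -> (0 < r)%R -> (r <= rad)%R -> (0 < mB x r)%R.
Proof. by move=> Ax r0 rr; rewrite -lte_fin -mBE//; exact: Apos. Qed.

Section beta_lower_bound.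
Variables (p : R) (delta C : R).
Hypothesis p_gt0 : (0 < p)%R.
Hypothesis delta01 : (0 < delta <= 1)%R.
Hypothesis C_gt0 : (0 < C)%R.
Hypothesis C_dbl : forall x r, A x -> (0 < r)%R -> (16 / delta * r <= rad)%R ->
  mu (eball x (16 / delta * r)) <= C%:E * mu (eball x r).

Variables (E : set 'rV[R]_N) (x y : 'rV[R]_N) (rk r : R).
Hypothesis EA : E `<=` A.
Hypothesis rk_gt0 : (0 < rk)%R.
Hypothesis rk_rad : (8 * rk <= rad)%R.
Hypothesis Exrk : ~ flat E delta x rk.
Hypothesis xy : (enorm (y - x) < rk / 2)%R.
Hypothesis r34 : (3 * rk <= r <= 4 * rk)%R.

(** If [E] is not close to a line near [x], then, whatever the line, a point of
    [E] far from it has around it a ball carrying a fixed proportion of the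
    mass, by doubling. *)
Lemma beta_number_ge : (delta / 8 * C^-1 `^ p^-1)%:E <= beta_number mu p y r.
Proof.
have /andP[d0 d1] := delta01; have /andP[r3 r4] := r34.
have rk0 := rk_gt0; have rk8 := rk_rad; have yx := xy.
have r0 : (0 < r)%R by lra.
apply/ereal_infP => _ [L Ll <-].
have [z [Ez zx zL]] : exists z, [/\ E z, (enorm (z - x) <= rk)%R &
    forall w, L w -> (delta * rk < enorm (z - w))%R].
  apply: contrapT => h; apply: Exrk; exists L => // z Ez zx.
  apply: contrapT => h2; apply: h; exists z; split => // w Lw.
  by rewrite ltNge; apply/negP => zw; apply: h2; exists w.
have Az := EA Ez.
pose eta := (delta * rk / 2)%R.
have eta0 : (0 < eta)%R by rewrite divr_gt0// mulr_gt0.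
have eta_rk : (eta <= rk / 2)%R by rewrite ler_pM2r// ler_piMl// ltW.
have yz := enorm_triangle x y z; have zy := enorm_triangle x z y.
rewrite (enormC x z) in yz; rewrite (enormC x y) in zy.
have B1 : eball z eta `<=` eball y r by apply: sub_eball; lra.
have B2 : eball y r `<=` eball z (8 * rk) by apply: sub_eball; lra.
have vfin : mu (eball y r) \is a fin_num.
  rewrite ge0_fin_numE ?outer_measure_ge0//.
  by rewrite (le_lt_trans (le_outer_measure mu _ _ B2))// mBE// ltry.
pose v := fine (mu (eball y r)).
have vE : mu (eball y r) = v%:E by rewrite fineK.
have eta_rad : (eta <= rad)%R by lra.
have e0 := mB_gt0 Az eta0 eta_rad.
have ve : (mB z eta <= v)%R.
  by rewrite -lee_fin -vE -mBE//; exact: le_outer_measure.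
have v0 : (0 < v)%R by exact: lt_le_trans ve.
have vC : (v <= C * mB z eta)%R.
  rewrite -lee_fin EFinM -vE -mBE//.
  have e8 : (16 / delta * eta = 8 * rk)%R.
    by rewrite /eta; field; rewrite gt_eqF.
  apply: (le_trans (le_outer_measure mu _ _ B2)); rewrite -e8.
  by apply: C_dbl => //; rewrite e8.
rewrite /beta_line.
have -> : (delta / 8 * C^-1 `^ p^-1)%:E = ((delta / 8) `^ p / C)%:E `^ p^-1.
  rewrite poweR_EFin powRM ?powR_ge0 ?invr_ge0 ?(ltW C_gt0)//.
  by rewrite -powRrM divff ?gt_eqF// powRr1// divr_ge0// ltW.
have d8 : (0 <= (delta / 8) `^ p)%R by exact: powR_ge0.
apply: gt0_ler_poweR; rewrite ?invr_ge0 ?(ltW p_gt0)//.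
- by rewrite in_itv/= lee_fin divr_ge0 ?(ltW C_gt0)// leey.
- rewrite in_itv/= leey andbT; apply: integral_ge0 => w _.
  by rewrite vE inver gt_eqF// lee_fin mulr_ge0 ?powR_ge0// invr_ge0 ltW.
apply: (@le_trans _ _ (\sum_(i <- [:: tt])
    ((delta / 8) `^ p / v)%:E * mu (eball z eta))).
  rewrite big_seq1 mBE// -EFinM lee_fin -!mulrA ler_wpM2l//.
  by rewrite ler_pdivlMl// ler_pdivrMr// mulrC.
apply: (@integral_ge_step _ (caratheodory_type mu) _ mu unit [:: tt] _
  (fun=> eball z eta)) => //.
- exact: mball.
- by move=> _; exact: mball.
- by move=> _; rewrite divr_ge0// ltW.
move=> w yw; rewrite big_seq1 vE inver gt_eqF// -EFinM lee_fin.
rewrite indicE; have [zw|_] := boolP (w \in _); last first.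
  by rewrite mulr0 mulr_ge0 ?powR_ge0// invr_ge0 ltW.
rewrite mulr1 ler_pM2r ?invr_gt0//.
have etaL : (eta <= edist_set w L)%R.
  apply: lb_le_inf.
    have [a [u [_ ->]]] := Ll; pose w0 := (a + 0 *: u)%R.
    by exists (enorm (w - w0)), w0 => //; exists 0%R.
  move=> _ [u Lu <-]; have := zL u Lu; have := enorm_triangle w z u.
  have : (enorm (w - z) < eta)%R by rewrite inE in zw.
  by rewrite (enormC z w) /eta; lra.
apply: ge0_ler_powR; rewrite ?nnegrE ?(ltW p_gt0)//.
- by rewrite divr_ge0// ltW.
- by rewrite divr_ge0 ?(ltW r0)// (le_trans _ etaL)// ltW.
rewrite ler_pdivlMr//; apply: le_trans etaL.
rewrite /eta mulrAC ler_pdivrMr//; have := ler_wpM2l (ltW d0) r4; lra.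
Qed.

End beta_lower_bound.

End doubling.

(** * Sets with uniform bounds *)

Section piece.
Local Open Scope ereal_scope.
Variables (R : realType) (N : nat).
Variable mu : {outer_measure set 'rV[R]_N -> \bar R}.
Hypothesis mball : forall x r, mu.-caratheodory (eball x r).
Variables (A : set 'rV[R]_N) (rad D M p q s : R).
Hypothesis Apos : forall x r, A x -> (0 < r)%R -> 0 < mu (eball x r).
Hypothesis Afin : forall x, A x -> mu (eball x rad) < +oo.
Hypothesis Adbl : forall x r, A x -> (0 < r <= rad)%R ->
  mu (eball x (2 * r)) <= D%:E * mu (eball x r).
Hypothesis D_ge1 : (1 <= D)%R.
Hypothesis AJ : forall x, A x -> jones_function mu s p q x <= M%:E.
Hypothesis p_gt0 : (0 < p)%R.
Hypothesis q_gt0 : (0 < q)%R.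
Hypothesis s_gt1 : (1 < s)%R.
Variables (r0 rho : R).
Hypothesis r0_gt0 : (0 < r0)%R.
Hypothesis rho_gt0 : (0 < rho)%R.
Hypothesis rho_le : (rho <= 2^-1)%R.
Hypothesis r0_rad : (8 * r0 <= rad)%R.
Hypothesis rad_le1 : (rad <= 1)%R.
Let r k : R := (r0 * rho ^+ k)%R.

Let r_gt0 k : (0 < r k)%R. Proof. by rewrite mulr_gt0// exprn_gt0. Qed.

Let rho_le1 : (rho <= 1)%R.
Proof. by rewrite (le_trans rho_le)// invf_le1// ler1n. Qed.

Let r_noninc j k : (j <= k)%N -> (r k <= r j)%R.
Proof. by move=> jk; rewrite ler_pM2l// ler_wiXn2l// ltW. Qed.

Let r_half j k : (j < k)%N -> (r k <= 2^-1 * r j)%R.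
Proof.
move=> jk; rewrite (le_trans (r_noninc jk))// /r exprS mulrCA.
by rewrite ler_wpM2r// ltW// r_gt0.
Qed.

Let r_rad k : (8 * r k <= rad)%R.
Proof.
apply: le_trans r0_rad; rewrite ler_pM2l//.
by rewrite -[leRHS]mulr1 -(expr0 rho); exact: (r_noninc (leq0n k)).
Qed.

Let mB x t : R := fine (mu (eball x t)).

Let mB_ge0 x t : (0 <= mB x t)%R.
Proof. by rewrite fine_ge0// outer_measure_ge0. Qed.

Let mBE x t : A x -> (t <= rad)%R -> mu (eball x t) = (mB x t)%:E.
Proof.
move=> Ax rr; rewrite /mB fineK// ge0_fin_numE ?outer_measure_ge0//.
by apply: le_lt_trans (Afin Ax); apply: le_outer_measure; exact: le_eball.
Qed.

Let mB_gt0 x t : A x -> (0 < t)%R -> (t <= rad)%R -> (0 < mB x t)%R.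
Proof. by move=> Ax t0 tr; rewrite -lte_fin -mBE//; exact: Apos. Qed.

Let half_rad k : (r k / 2 <= rad)%R.
Proof. by have := r_rad k; have := r_gt0 k; lra. Qed.

Let bad (E : set 'rV[R]_N) k x := `[< ~ flat E (rho / 4) x (r k) >].

Let weight (c : R) k x : R := (c * r k `^ s / mB x (r k / 2))%R.

Let weight_ge0 c k x : (0 <= c)%R -> (0 <= weight c k x)%R.
Proof. by move=> c0; rewrite /weight mulr_ge0 ?invr_ge0// mulr_ge0// powR_ge0. Qed.

(** A nonflat ball of radius [r k] makes the integrand of the Jones function of
    each of its points of [A] large on [[3 * r k, 4 * r k]]; these intervals are
    disjoint for different [k]. *)
Lemma jones_packing : exists2 c : R, (0 < c)%R &
  forall (E : set 'rV[R]_N) (nets : nat -> seq 'rV[R]_N) n,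
  E `<=` A -> (forall k, separated (r k) (nets k)) ->
  (forall k x, x \in nets k -> E x) -> forall y, A y ->
  (\sum_(k < n) \sum_(x <- nets k | bad E k x)
     weight c k x * \1_(eball x (r k / 2)) y <= M)%R.
Proof.
pose delta := (rho / 4)%R.
have delta01 : (0 < delta <= 1)%R.
  by have := rho_gt0; have := rho_le1; rewrite /delta; lra.
have d0 : (0 < delta)%R by case/andP: delta01.
have lam1 : (0 < 16 / delta)%R by rewrite divr_gt0.
have [C C0 CP] := doubling_iter Adbl D_ge1 lam1.
have [C' C'0 C'P] := doubling_iter Adbl D_ge1 (ltr0n R 16).
pose eps := (delta / 8 * C^-1 `^ p^-1)%R.
have eps0 : (0 < eps)%R by rewrite mulr_gt0 ?divr_gt0 ?powR_gt0 ?invr_gt0.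
pose c := (eps `^ q / (4 * C'))%R.
have c0 : (0 < c)%R by apply: divr_gt0; [exact: powR_gt0|exact: mulr_gt0].
exists c => // E nets n EA nsep netE y Ay.
rewrite -lee_fin; apply: le_trans (AJ Ay); rewrite /jones_function.
set h := (X in \int[_]_(t in _) X t).
have h0 t : (0 < t < 1)%R -> 0 <= h t.
  move=> /andP[t0 _]; rewrite /h; apply: mule_ge0; last by rewrite lee_fin invr_ge0 ltW.
  apply: mule_ge0; first exact: poweR_ge0.
  by apply: mule_ge0; rewrite ?lee_fin ?powR_ge0// inve_ge0 outer_measure_ge0.
pose b k := (\sum_(x <- nets k | bad E k x)
     weight c k x * \1_(eball x (r k / 2)) y)%R.
have b0 k : (0 <= b k)%R.
  by apply: sumr_ge0 => x _; rewrite mulr_ge0// weight_ge0// ltW.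
pose J k : set R := `[(3 * r k)%R, (4 * r k)%R]%classic.
have -> : (\sum_(k < n) b k)%:E =
    \sum_(k < n) (b k / r k)%:E * lebesgue_measure (J k).
  rewrite -sumEFin; apply: eq_bigr => k _; have rk := r_gt0 k.
  rewrite /J lebesgue_measure_itv/= lte_fin ltr_pM2r// ltr_nat/= -EFinB -EFinM.
  by rewrite -mulrBl (_ : 4 - 3 = 1 :> R)%R ?mul1r ?divfK ?gt_eqF//; lra.
apply: (@integral_ge_step _ _ R lebesgue_measure 'I_n (index_enum 'I_n)
  `]0%R, 1%R[%classic (fun k : 'I_n => J k)
  (fun k : 'I_n => b k / r k)%R h) => //.
- by move=> k; exact: measurable_itv.
- move=> k t; rewrite /J /= !in_itv/= => /andP[t3 t4].
  have := r_gt0 k; have := r_rad k; have := rad_le1; lra.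
- by move=> k; rewrite divr_ge0// ltW.
move=> t /=; rewrite in_itv/= => t01.
have disj : {in index_enum 'I_n &, forall i j : 'I_n,
    J i t -> J j t -> i = j}.
  move=> i j _ _; rewrite /J /= !in_itv/= => /andP[i3 i4] /andP[j3 j4].
  apply/val_inj; case: (ltngtP i j) => // /r_half h'; exfalso.
  - by have := r_gt0 i; lra.
  - by have := r_gt0 j; lra.
have [->|[k _ [tk ->]]] := @sum_indic_at_most_one R R 'I_n (index_enum 'I_n)
  (fun k : 'I_n => b k / r k)%R (fun k : 'I_n => J k) t
  (index_enum_uniq 'I_n) disj; first exact: h0.
have rk0 := r_gt0 k.
pose l := [seq x <- nets k | bad E k x].
have bE : (b k = \sum_(x <- l) weight c k x * \1_(eball x (r k / 2)) y)%R.
  by rewrite /b /l big_filter.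
have [ul sl] : separated (r k) l by exact: separated_filter.
have disjy : {in l &, forall x z, eball x (r k / 2) y -> eball z (r k / 2) y -> x = z}.
  move=> x z xl zl xy zy; apply/eqP/negP => /negP /(sl _ _ xl zl).
  move: xy zy; rewrite /eball /= => xy zy; have := enorm_triangle y x z.
  by rewrite (enormC x y); lra.
have [e|[x xl [xy e]]] := @sum_indic_at_most_one R 'rV[R]_N 'rV[R]_N l (weight c k)
  (fun x => eball x (r k / 2)) y ul disjy.
  by rewrite bE e mul0r; exact: h0.
rewrite bE e {e}; move: xl; rewrite mem_filter => /andP[/asboolP xbad xk].
have Ax : A x by apply: EA; exact: netE xk.
move: tk; rewrite /J /= in_itv/= => t34; have /andP[t3 t4] := t34.
have rk8 := r_rad k; rewrite /eball /= in xy.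
have t0 : (0 < t)%R by lra.
have By : eball y t `<=` eball x (8 * r k) by apply: sub_eball; lra.
have vC : mu (eball y t) <= (C' * mB x (r k / 2))%:E.
  apply: (le_trans (le_outer_measure mu _ _ By)).
  rewrite EFinM -mBE// (_ : 8 * r k = 16 * (r k / 2))%R; last by field.
  by apply: C'P => //; [rewrite divr_gt0|lra].
have vfin : mu (eball y t) \is a fin_num.
  by rewrite ge0_fin_numE ?outer_measure_ge0// (le_lt_trans vC)// ltry.
pose v := fine (mu (eball y t)).
have vE : mu (eball y t) = v%:E by rewrite fineK.
have v0 : (0 < v)%R by rewrite -lte_fin -vE; exact: Apos.
rewrite vE lee_fin in vC.
have m0 : (0 < mB x (r k / 2))%R by apply: mB_gt0 => //; rewrite divr_gt0.
have beta_ge : (eps `^ q)%:E <= beta_number mu p y t `^ q.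
  rewrite -poweR_EFin; apply: gt0_ler_poweR; first exact: ltW.
  - by rewrite in_itv/= lee_fin leey andbT ltW.
  - rewrite in_itv/= leey andbT; apply/ereal_infP => _ [L _ <-]; exact: poweR_ge0.
  - exact: (beta_number_ge mball Apos Afin p_gt0 delta01 C0 CP EA rk0 rk8 xbad xy t34).
rewrite /h vE inver gt_eqF//.
apply: (@le_trans _ _ ((eps `^ q)%:E * ((r k `^ s)%:E * (C' * mB x (r k / 2))^-1%:E) *
    ((4 * r k)^-1)%:E)).
  rewrite -!EFinM lee_fin /weight /c le_eqVlt; apply/orP; left; apply/eqP.
  by field; rewrite !gt_eqF.
have m1 : (0 <= (C' * mB x (r k / 2))^-1)%R.
  by rewrite invr_ge0; exact/ltW/mulr_gt0.
apply: lee_pmul.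
- by rewrite -!EFinM lee_fin mulr_ge0 ?powR_ge0// mulr_ge0// powR_ge0.
- by rewrite lee_fin invr_ge0; exact/ltW/mulr_gt0.
- apply: lee_pmul => //.
  + by rewrite lee_fin powR_ge0.
  + by rewrite -EFinM lee_fin mulr_ge0// powR_ge0.
  + rewrite -!EFinM lee_fin; apply: ler_pM; rewrite ?powR_ge0//.
      apply: ge0_ler_powR; rewrite ?nnegrE ?(ltW t0) ?(ltW rk0)//; last lra.
      by rewrite (le_trans _ (ltW s_gt1)).
    by rewrite lef_pV2 ?posrE// mulr_gt0.
- by rewrite lee_fin lef_pV2 ?posrE// mulr_gt0.
Qed.

(** Points of [A] at which [A] has density at least [kappa] at all scales. *)
Let dense kappa := [set x | A x /\ forall k,
  kappa%:E * mu (eball x (r k / 4)) <= mu (A `&` eball x (2 * (r k / 4)))].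

(** Integrating [jones_packing] over [A]: where [A] is dense, its mass in a ball
    cancels the normalization by the mass of that ball. *)
Lemma nonflat_content (kappa : R) : (0 < kappa)%R -> (0 <= M)%R -> mu A < +oo ->
  exists C : R, forall (nets : nat -> seq 'rV[R]_N) n,
  (forall k, separated (r k) (nets k)) ->
  (forall k x, x \in nets k -> dense kappa x) ->
  (\sum_(k < n) \sum_(x <- nets k | bad (dense kappa) k x) r k `^ s <= C)%R.
Proof.
move=> kappa0 M0 muA; have [c c0 cP] := jones_packing.
have D0 : (0 < D)%R by exact: lt_le_trans D_ge1.
have muAE : mu A = (fine (mu A))%:E.
  by rewrite fineK// ge0_fin_numE// outer_measure_ge0.
exists (M * fine (mu A) * (D / (c * kappa)))%R => nets n nsep netE.
have dA : dense kappa `<=` A by move=> x [].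
pose l := [seq (k, x) | k <- index_iota 0 n,
  x <- [seq x <- nets k | bad (dense kappa) k x]].
pose a (i : nat * 'rV[R]_N) := weight c i.1 i.2.
pose B (i : nat * 'rV[R]_N) := eball i.2 (r i.1 / 2).
have := @weighted_overlap R _ mu _ l a B _ _ A M M0.
move=> /(_ (fun i => weight_ge0 _ _ (ltW c0)) (fun i => mball _ _)) H.
have {H} : \sum_(i <- l) (a i)%:E * mu (A `&` B i) <= M%:E * mu A.
  apply: H => y Ay; rewrite big_allpairs_dep big_mkord.
  under eq_bigr do rewrite big_filter.
  exact: cP.
rewrite muAE -EFinM => H.
rewrite -lee_fin.
rewrite -(@lee_pmul2l _ (c * kappa / D)%:E)//; last first.
  by rewrite lte_fin divr_gt0// mulr_gt0.
apply: (@le_trans _ _ (M * fine (mu A))%:E); last first.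
  rewrite -EFinM lee_fin le_eqVlt; apply/orP; left; apply/eqP.
  by field; rewrite !gt_eqF.
apply: le_trans H; rewrite big_allpairs_dep big_mkord -sumEFin.
rewrite ge0_sume_distrr; last first.
  by move=> k _; rewrite lee_fin sumr_ge0// => x _; exact: powR_ge0.
apply: lee_sum => k _; rewrite big_filter -sumEFin ge0_sume_distrr; last first.
  by move=> x _; rewrite lee_fin powR_ge0.
rewrite big_seq_cond [leRHS]big_seq_cond; apply: lee_sum => x /andP[xk _].
have [Ax xd] := netE _ _ xk.
have rk0 := r_gt0 k; have r8 := r_rad k.
have r4 : (0 < r k / 4)%R by rewrite divr_gt0.
have r24 : (2 * (r k / 4) = r k / 2)%R by field.
have r4rad : (r k / 4 <= rad)%R by lra.
have dbl : (mB x (r k / 2) <= D * mB x (r k / 4))%R.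
  rewrite -lee_fin EFinM -!mBE// -r24; apply: Adbl => //.
  by rewrite r4.
have m0 : (0 < mB x (r k / 2))%R by apply: mB_gt0 => //; rewrite divr_gt0.
rewrite /a /B /=.
apply: (@le_trans _ _ ((weight c k x)%:E * (kappa * mB x (r k / 4))%:E)); last first.
  apply: lee_wpmul2l; first by rewrite lee_fin weight_ge0// ltW.
  by rewrite EFinM -mBE// -r24; exact: xd.
rewrite -!EFinM lee_fin /weight.
have -> : (c * kappa / D * r k `^ s = c * r k `^ s * kappa * D^-1)%R by ring.
have -> : (c * r k `^ s / mB x (r k / 2) * (kappa * mB x (r k / 4)) =
  c * r k `^ s * kappa * (mB x (r k / 4) / mB x (r k / 2)))%R by ring.
apply: ler_wpM2l; first by rewrite !mulr_ge0 ?powR_ge0// ltW.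
by rewrite ler_pdivlMr// ler_pdivrMl// mulrC.
Qed.

Hypothesis rho_small : ((8 / rho + 3) * rho `^ s <= 2^-1)%R.
Hypothesis A_small : forall x y, A x -> A y -> (enorm (x - y) <= r0)%R.

Lemma holder_curve_point (x : 'rV[R]_N) : holder_curve s [set x].
Proof.
exists (fun=> x), 0%R; split.
  by move=> ? ? _ _; rewrite subrr enorm0 mul0r.
apply/seteqP; split => [_ ->|_ [t _ <-]//].
by exists 0%R => //=; rewrite in_itv/= lexx ler01.
Qed.

(** [A] is covered, up to a null set, by its subsets [dense n.+1%:R^-1], and
    each of them lies on one curve. *)
Lemma piece_carried : exists G : (set 'rV[R]_N)^nat,
  (forall i, holder_curve s (G i)) /\ mu (A `\` \bigcup_i G i) = 0.
Proof.
have [[x0 Ax0]|A0] := pselect (A !=set0); last first.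
  exists (fun=> [set 0%R]); split; first by move=> _; exact: holder_curve_point.
  rewrite (_ : A `\` _ = set0) ?outer_measure0//; apply/seteqP; split => // x [Ax _].
  by apply: A0; exists x.
have r0' := r0_gt0; have r8 := r0_rad.
have Asub : A `<=` eball x0 (2 * r0).
  by move=> x Ax; rewrite /eball /=; have := A_small Ax Ax0; lra.
have muA : mu A < +oo.
  apply: le_lt_trans (Afin Ax0); apply: le_outer_measure.
  by apply: (subset_trans Asub); apply: le_eball; lra.
have M0 : (0 <= M)%R.
  rewrite -lee_fin; apply: le_trans (AJ Ax0); apply: integral_ge0 => t /=.
  rewrite in_itv/= => /andP[t0 _].
  apply: mule_ge0; last by rewrite lee_fin invr_ge0 ltW.
  apply: mule_ge0; first exact: poweR_ge0.
  by apply: mule_ge0; rewrite ?lee_fin ?powR_ge0// inve_ge0 outer_measure_ge0.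
pose kap n : R := (n.+1%:R^-1)%R.
have kap0 n : (0 < kap n)%R by rewrite invr_gt0 ltr0n.
have curve n : exists G, holder_curve s G /\ dense (kap n) `<=` G.
  have [[z dz]|nz] := pselect (dense (kap n) !=set0); last first.
    exists [set 0%R]; split; first exact: holder_curve_point.
    by move=> x dx; exfalso; apply: nz; exists x.
  have [C CP] := nonflat_content (kap0 n) M0 muA.
  have small x : dense (kap n) x -> (enorm (x - z) <= r0)%R.
    by move=> [Ax _]; apply: A_small => //; case: dz.
  have [G hG dG] := summable_nonflat_holder_curve r0_gt0 rho_gt0 rho_le
    (ltW s_gt1) rho_small dz small CP.
  by exists G.
have /choice[G GP] := curve.
exists G; split; first by move=> i; case: (GP i).
pose V := fine (mu (eball x0 rad)).
have VE : mu (eball x0 rad) = V%:E.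
  by rewrite fineK// ge0_fin_numE ?outer_measure_ge0// Afin.
have bound n : mu (A `\` \bigcup_i G i) <= (kap n * V)%:E.
  have := @low_density_measure R N mu mball A x0 r0 (kap n) (fun k => r k / 4)%R
    (fun z Az => A_small Az Ax0).
  move=> /(_ _ _ (ltW (kap0 n))) low.
  apply: le_trans (le_trans (low _ _) _).
  - apply: le_outer_measure => x [Ax nGx].
    have : ~ dense (kap n) x by move=> dx; apply: nGx; exists n => //; case: (GP n) => _; apply.
    move=> nd; apply: contrapT => nlow; apply: nd; split => // k.
    rewrite leNgt; apply/negP => lt; apply: nlow; exists k => //; split => //.
    exact: ltW.
  - by move=> k; rewrite divr_gt0.
  - by move=> j k jk; rewrite ler_pM2r// r_noninc.
  - rewrite EFinM -VE; apply: lee_wpmul2l; first by rewrite lee_fin ltW.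
    by apply: le_outer_measure; apply: le_eball; rewrite /r expr0; lra.
apply/eqP; rewrite eq_le outer_measure_ge0 andbT.
apply/lee_addgt0Pr => e e0; rewrite add0e.
have V0 : (0 <= V)%R by rewrite fine_ge0// outer_measure_ge0.
pose n := Num.truncn (V / e).
apply: (le_trans (bound n)); rewrite lee_fin /kap mulrC ler_pdivrMr ?ltr0n//.
have /truncn_itv/andP[_] : (0 <= V / e)%R by rewrite divr_ge0// ltW.
by rewrite -/n ltr_pdivrMr// mulrC => /ltW.
Qed.

End piece.

(** * Decomposition into pieces *)

(** It suffices that [10 * rho `^ (s - 1) <= 2^-1]; this is where [1 < s] is
    used. *)
Lemma exists_contraction_ratio (R : realType) (s : R) : 1 < s ->
  exists rho : R, [/\ 0 < rho, rho <= 2^-1 & (8 / rho + 3) * rho `^ s <= 2^-1].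
Proof.
move=> s1; have s10 : 0 < s - 1 by rewrite subr_gt0.
pose u : R := (20^-1) `^ (s - 1)^-1.
have u0 : 0 < u by rewrite powR_gt0// invr_gt0.
have us : u `^ (s - 1) = 20^-1.
  by rewrite -powRrM mulVf ?gt_eqF// powRr1// invr_ge0.
pose rho := Num.min (2^-1) u.
have rho0 : 0 < rho by rewrite /rho lt_min u0 invr_gt0 ltr0n.
have rhoh : rho <= 2^-1 by rewrite /rho ge_min lexx.
have rhou : rho <= u by rewrite /rho ge_min lexx orbT.
exists rho; split => //.
have -> : rho `^ s = rho * rho `^ (s - 1).
  have e1 : (1 + (s - 1) == 0) ==> (rho != 0) by rewrite (gt_eqF rho0) implybT.
  by have := powRD e1; rewrite powRr1 ?(ltW rho0)// addrCA subrr addr0.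
have small : rho `^ (s - 1) <= 20^-1.
  by rewrite -us; apply: ge0_ler_powR; rewrite ?nnegrE//; exact: ltW.
rewrite mulrA mulrDl divfK ?gt_eqF//.
have : 8 + 3 * rho <= 10 by lra.
have := powR_ge0 rho (s - 1); nra.
Qed.

Section decomposition.
Variables (R : realType) (N : nat).
Variable mu : {outer_measure set 'rV[R]_N -> \bar R}.
Variables (s p q : R).

(** The [m]-th piece of the cell [z]: the quantitative hypotheses hold with
    constants controlled by [m], and the cell, a cube, has diameter at most an
    eighth of the radius [m.+1%:R^-1]. *)
Definition piece (m : nat) (z : 'rV[int]_N) : set 'rV[R]_N :=
  [set x | [/\ msupport mu x, (jones_function mu s p q x <= m%:R%:E)%E,
    (forall r : R, 0 < r <= m.+1%:R^-1 ->
       (mu (eball x (2 * r)) <= m.+1%:R%:E * mu (eball x r))%E),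
    (mu (eball x m.+1%:R^-1) < +oo)%E &
    forall i, Num.floor (x 0 i * (8 * m.+1%:R * N.+1%:R)) = z 0 i]].

Lemma piece_diam m z x y : piece m z x -> piece m z y ->
  enorm (x - y) <= m.+1%:R^-1 / 8.
Proof.
move=> [_ _ _ _ xz] [_ _ _ _ yz].
set h : R := 8 * m.+1%:R * N.+1%:R in xz yz.
have h0 : 0 < h by rewrite !mulr_gt0.
apply: (@le_trans _ _ (N%:R * h^-1)).
  apply: enorm_le_coord; first by rewrite invr_ge0 ltW.
  move=> i; rewrite !mxE -[leRHS]mul1r ler_pdivlMr//.
  rewrite -[X in _ * X](gtr0_norm h0) -normrM mulrBl ler_norml.
  have /andP[x1 x2] := Num.Theory.floor_itv (x 0 i * h).
  have /andP[y1 y2] := Num.Theory.floor_itv (y 0 i * h).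
  rewrite xz in x1 x2; rewrite yz in y1 y2.
  rewrite intrD in x2; rewrite intrD in y2; lra.
rewrite /h !invfM mulrCA [m.+1%:R^-1 / 8]mulrC; apply: ler_piMr.
  by rewrite mulr_ge0.
by rewrite ler_pdivrMr// mul1r ler_nat.
Qed.

Lemma eventually_doubling x : locally_finite_measure mu -> msupport mu x ->
  (upper_doubling mu x < +oo)%E ->
  exists c e : R, 0 < e /\ forall r, 0 < r < e ->
    (mu (eball x (2 * r)) <= c%:E * mu (eball x r))%E.
Proof.
move=> lf xs /ereal_inf_lt[_ [V V0 <-] Vy].
have [e1 e10 e1fin] := lf x.
have [e2 e20 e2V] : exists2 e : R, 0 < e & forall r, 0 < r < e -> V r.
  move: V0 => /nbhs_ballP[e /= e0 eV]; exists e => // r /andP[r0 re].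
  by apply: eV => //; rewrite /ball /= sub0r normrN gtr0_norm.
set y := ereal_sup _ in Vy.
exists (fine y), (Num.min e1 e2); split; first by rewrite lt_min e10.
move=> r; rewrite lt_min => /and3P[r0 r1 r2].
have v0 := xs r r0.
have vfin : mu (eball x r) \is a fin_num.
  rewrite ge0_fin_numE ?outer_measure_ge0//; apply: le_lt_trans e1fin.
  by apply: le_outer_measure; apply: le_eball; exact: ltW.
pose v := fine (mu (eball x r)).
have vE : mu (eball x r) = v%:E by rewrite fineK.
rewrite vE lte_fin in v0.
have : (mu (eball x (2 * r)) / mu (eball x r) <= y)%E.
  by apply: ereal_sup_ubound; exists r => //; apply: e2V; rewrite r0.
have yfin : (y <= (fine y)%:E)%E by case: (y) Vy => [a _|//|_]; rewrite ?lexx ?leNye.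
rewrite vE inver gt_eqF// => /le_trans /(_ yfin).
by rewrite lee_pdivrMr.
Qed.

Lemma piece_cover x : locally_finite_measure mu -> msupport mu x ->
  (jones_function mu s p q x < +oo)%E -> (upper_doubling mu x < +oo)%E ->
  exists m z, piece m z x.
Proof.
move=> lf xs Jx Dx; have [c [e [e0 ec]]] := eventually_doubling lf xs Dx.
have [e1 e10 e1fin] := lf x.
pose j := fine (jones_function mu s p q x).
pose m := Num.truncn (`|j| + `|c| + e^-1 + e1^-1).
have mP : `|j| + `|c| + e^-1 + e1^-1 < m.+1%:R.
  have /truncn_itv/andP[] // : 0 <= `|j| + `|c| + e^-1 + e1^-1.
  by rewrite !addr_ge0// invr_ge0 ltW.
have j0 : 0 <= `|j| by []. have c0 : 0 <= `|c| by [].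
have ie0 : 0 < e^-1 by rewrite invr_gt0.
have ie10 : 0 < e1^-1 by rewrite invr_gt0.
have jm : j <= m.+1%:R by have := ler_norm j; lra.
have cm : c <= m.+1%:R by have := ler_norm c; lra.
have em : m.+2%:R^-1 < e.
  rewrite -[ltRHS]invrK ltf_pV2 ?posrE// -natr1; lra.
have e1m : m.+2%:R^-1 < e1.
  rewrite -[ltRHS]invrK ltf_pV2 ?posrE// -natr1; lra.
exists m.+1, (\row_i Num.floor (x 0 i * (8 * m.+2%:R * N.+1%:R))); split => //.
- apply: (@le_trans _ _ j%:E); last by rewrite lee_fin.
  by rewrite /j; case: (jones_function _ _ _ _ _) Jx => [a _|//|_]; rewrite ?lexx ?leNye.
- move=> r /andP[r0 rm]; apply: (le_trans (ec r _)).
    by rewrite r0 (le_lt_trans rm).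
  apply: lee_wpmul2r; first exact: outer_measure_ge0.
  by rewrite lee_fin (le_trans cm)// ler_nat.
- apply: le_lt_trans e1fin; apply: le_outer_measure; apply: le_eball.
  exact: ltW.
- by move=> i; rewrite mxE.
Qed.

End decomposition.

Theorem theorem7p5 (R : realType) (N : nat) (hN : (2 <= N)%N)
    (mu : {outer_measure set 'rV[R]_N -> \bar R}) (hmu : radon_measure mu)
    (s p q : R) (hs : 1 < s) (hp : 0 < p) (hq : 0 < q) :
  carried_by_holder_curves s
    (omrestr mu
       [set x | [/\ msupport mu x,
                    (jones_function mu s p q x < +oo)%E
                  & (upper_doubling mu x < +oo)%E]]).
Proof.
have [[mborel _] lf] := hmu.
have mball x r : mu.-caratheodory (eball x r) by apply: mborel; exact: borel_eball.
have [rho [rho0 rho2 rhos]] := exists_contraction_ratio hs.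
have carried (mz : nat * 'rV[int]_N) : exists G : (set 'rV[R]_N)^nat,
    (forall i, holder_curve s (G i)) /\
    mu (piece mu s p q mz.1 mz.2 `\` \bigcup_i G i) = 0%E.
  move: mz => [m z] /=.
  have m0 : 0 < m.+1%:R^-1 :> R by rewrite invr_gt0.
  apply: (@piece_carried R N mu mball _ m.+1%:R^-1 m.+1%:R m%:R p q s
    _ _ _ _ _ hp hq hs (m.+1%:R^-1 / 8) rho _ rho0 rho2) => //.
  - by move=> x r [xs _ _ _ _]; exact: xs.
  - by move=> x [].
  - by move=> x r [_ _ h _ _]; exact: h.
  - by rewrite ler1n.
  - by move=> x [].
  - by rewrite mulrCA divff ?mulr1.
  - by rewrite invf_le1// ler1n.
  - by move=> x y; exact: piece_diam.
have /choice[G GP] := carried.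
pose c0 : set 'rV[R]_N := [set 0].
exists (fun n => if @unpickle (nat * 'rV[int]_N * nat)%type n is Some (mz, i)
  then G mz i else c0); split.
  move=> n; case: unpickle => [[mz i]|]; last exact: holder_curve_point.
  by case: (GP mz).
rewrite /omrestr; set U := \bigcup_n _; set T := [set x | _].
pose F n := if @unpickle (nat * 'rV[int]_N)%type n is Some mz
  then piece mu s p q mz.1 mz.2 `\` \bigcup_i G mz i else set0.
apply/eqP; rewrite eq_le outer_measure_ge0 andbT.
have F0 : mu (\bigcup_n F n) = 0%E.
  apply: outer_measure_null_bigcup => n; rewrite /F.
  by case: unpickle => [mz|]; [case: (GP mz)|exact: outer_measure0].
rewrite -F0; apply: le_outer_measure => x [nU [xs xJ xD]].
have [m [z xmz]] := piece_cover lf xs xJ xD.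
exists (pickle (m, z)) => //; rewrite /F pickleK; split => //.
move=> [i _ Gx]; apply: nU; exists (pickle (m, z, i)) => //.
by rewrite pickleK.
Qed.
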